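(* Let $G$ be a ($P_6$, diamond)-free graph. Then $\chi(G)\leq \max\{6,\omega(G)\}$.
   Context: All graphs are finite and simple. $P_n$ and $K_n$ denote the path and the complete graph on $n$ vertices. The diamond is the graph obtained from $K_4$ by removing an edge. A graph $G$ contains a graph $H$ if some induced subgraph of $G$ is isomorphic to $H$; $G$ is $(H_1,\ldots,H_n)$-free if it contains none of $H_1,\ldots,H_n$. $\chi(G)$ is the chromatic number of $G$ and $\omega(G)$ is the clique number (size of a largest clique) of $G$. *)

(* Defs.v *)
From mathcomp Require Import all_boot.

Set Implicit Arguments.
Unset Strict Implicit.
Unset Printing Implicit Defensive.

Record sgraph := SGraph {
  vertex :> finType;
  edge : rel vertex;
  edge_sym : symmetric edge;
  edge_irr : irreflexive edge
}.

Definition isomorphic (G H : sgraph) : Prop :=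
  exists2 f : G -> H, bijective f & forall x y, edge (f x) (f y) = edge x y.

Section Induced.
Variables (G : sgraph) (S : {set G}).

Definition induced_edge : rel {x : G | x \in S} :=
  fun x y => edge (val x) (val y).

Fact induced_edge_sym : symmetric induced_edge.
Proof. by move=> x y; apply: edge_sym. Qed.

Fact induced_edge_irr : irreflexive induced_edge.
Proof. by move=> x; apply: edge_irr. Qed.

Definition induced : sgraph := SGraph induced_edge_sym induced_edge_irr.
End Induced.

Definition contains (G H : sgraph) : Prop :=
  exists S : {set G}, isomorphic (induced S) H.

Section Path.
Variable n : nat.

Definition path_edge : rel 'I_n := fun i j => (i.+1 == j) || (j.+1 == i).

Fact path_edge_sym : symmetric path_edge.
Proof. by move=> i j; apply: orbC. Qed.

Fact path_edge_irr : irreflexive path_edge.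
Proof. by move=> i; rewrite /path_edge orbb gtn_eqF. Qed.

(* [n] counts vertices, not edges. *)
Definition path_graph : sgraph := SGraph path_edge_sym path_edge_irr.
End Path.

Section Complete.
Variable n : nat.

Definition complete_edge : rel 'I_n := fun i j => i != j.

Fact complete_edge_sym : symmetric complete_edge.
Proof. by move=> i j; rewrite /complete_edge eq_sym. Qed.

Fact complete_edge_irr : irreflexive complete_edge.
Proof. by move=> i; rewrite /complete_edge eqxx. Qed.

Definition complete_graph : sgraph := SGraph complete_edge_sym complete_edge_irr.
End Complete.

Section RemoveEdge.
Variables (G : sgraph) (u v : G).

Definition remove_edge_edge : rel G :=
  fun x y => edge x y && ([set x; y] != [set u; v]).

Fact remove_edge_edge_sym : symmetric remove_edge_edge.
Proof. by move=> x y; rewrite /remove_edge_edge edge_sym setUC. Qed.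

Fact remove_edge_edge_irr : irreflexive remove_edge_edge.
Proof. by move=> x; rewrite /remove_edge_edge edge_irr. Qed.

Definition remove_edge : sgraph :=
  SGraph remove_edge_edge_sym remove_edge_edge_irr.
End RemoveEdge.

Definition diamond : sgraph :=
  @remove_edge (complete_graph 4) (ord0 : 'I_4) (ord_max : 'I_4).

Definition clique (G : sgraph) (A : {set G}) : bool :=
  [forall x in A, forall y in A, (x != y) ==> edge x y].

Definition omega (G : sgraph) : nat := \max_(A : {set G} | clique A) #|A|.

Definition proper_coloring (G : sgraph) (k : nat) (c : {ffun G -> 'I_k}) : bool :=
  [forall x, forall y, edge x y ==> (c x != c y)].

Definition colorable (G : sgraph) (k : nat) : bool :=
  [exists c : {ffun G -> 'I_k}, proper_coloring c].

Fact colorable_exists (G : sgraph) : exists k, colorable G k.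
Proof.
exists #|G|; apply/existsP; exists [ffun x => enum_rank x].
apply/forallP=> x; apply/forallP=> y; apply/implyP=> xy.
by rewrite !ffunE (inj_eq enum_rank_inj); apply: contraTneq xy => ->; rewrite edge_irr.
Qed.

Definition chi (G : sgraph) : nat := ex_minn (colorable_exists G).

(* Main.v *)
(* Fix k = max(6, omega) and let G be a minimal graph in the class that is not k-colourable.
   Then G is connected, all degrees are at least k, no vertex is simplicial, and no
   neighbourhood contains that of another nonadjacent vertex. Moreover, by Kempe chains, if
   v lies on no C5 and G - v is k-coloured, then for any two colours a and b some edge in the
   neighbourhood of v has colours a and b. As cliques have at most k vertices, v is then in at
   least three maximal cliques.

   Let H be a small induced subgraph of G and list the possible traces on H of the other
   vertices. Each property of G above forces a further vertex, with one of a few traces on H.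
   Adding it and repeating gives a finite case tree, each branch of which ends with no
   possible trace, with a graph excluded before, or with a colouring of H and all the traces,
   hence of G. For the colourings: if K is a maximal clique, then a 3-colouring of G - K gives
   a colouring of G with max(6, |K|) colours, and in a K4-free graph two colours suffice for
   the neighbourhood of a vertex.

   These trees exclude, in order: a K4 having two vertices on a C5, so that the vertices of
   a K4 are in at least three maximal cliques; K4; C5, after a dozen larger graphs; and K3.
   But a graph without C5 has a triangle at every vertex, by Kempe chains again. *)
Require Import Defs.
From mathcomp Require Import all_boot.

Set Implicit Arguments.
Unset Strict Implicit.
Unset Printing Implicit Defensive.

(** * Certificates *)

(* A graph on an ordered vertex list is the list of its rows, each row giving the
   adjacency of a vertex to the LATER ones only; adding a vertex is then [cons], and the
   same list of bits is the type of an outside vertex, i.e. its trace on the graph. *)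
Definition row := seq bool.
Definition matrix := seq row.

Fixpoint cons_col (r : row) (R : seq row) : seq row :=
  match r, R with
  | b :: r', m :: R' => (b :: m) :: cons_col r' R'
  | _, _ => [::]
  end.

(** Recovers the full symmetric matrix, with a false diagonal, from its upper triangle. *)
Fixpoint rows (G : matrix) : seq row :=
  if G is r :: G' then (false :: r) :: cons_col r (rows G') else [::].

Fixpoint meet (a b : row) : row :=
  match a, b with
  | x :: a', y :: b' => (if x then y else false) :: meet a' b'
  | _, _ => [::]
  end.

Fixpoint minus (a b : row) : row :=
  match a, b with
  | x :: a', y :: b' => (if y then false else x) :: minus a' b'
  | _, _ => [::]
  end.

Definition bit (r : row) i := nth false r i.
Definition line (R : seq row) i := nth [::] R i.

Fixpoint adj (G : matrix) (i j : nat) : bool :=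
  match G, i, j with
  | _ :: G', i'.+1, j'.+1 => adj G' i' j'
  | r :: _, 0, j'.+1 => bit r j'
  | r :: _, i'.+1, 0 => bit r i'
  | _, _, _ => false
  end.

Fixpoint sub (G : matrix) (w : seq nat) : matrix :=
  if w is i :: w' then [seq adj G i j | j <- w'] :: sub G w' else [::].

(** Matrices are compared literally, not up to isomorphism, so [w] must list the vertices in the
    order chosen in [F]. *)
Definition occurs (F : seq matrix) (G : matrix) (w : seq nat) : bool :=
  [&& uniq w, all (fun i => i < size G) w & sub G w \in F].

(* The functions below look for an induced P6, diamond, K4 or C5 through a new vertex of
   type [T], which gets index 0. Nothing is proved about them: [occurs] rechecks the list
   they return. *)
Section Search.
Variables (R : seq row) (T : row).

Fixpoint pick (C : row) (R : seq row) (i : nat)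
    (f : nat -> row -> option (seq nat)) : option (seq nat) :=
  match C, R with
  | b :: C', r :: R' =>
    if b then (if f i r is Some w then Some w else pick C' R' i.+1 f)
    else pick C' R' i.+1 f
  | _, _ => None
  end.

Fixpoint arm k (av r : row) (w : seq nat) : option (seq nat) :=
  if k is k'.+1 then
    let av' := minus av r in
    pick (meet av r) R 1 (fun i ri => arm k' av' ri (i :: w))
  else Some w.

Definition orelse (a : option (seq nat)) (b : unit -> option (seq nat)) :=
  if a is Some w then Some w else b tt.

(** Up to reversal, the new vertex is the first, second or third vertex of the P6. *)
Definition find_path : option (seq nat) :=
  let full := [seq true | _ <- T] in
  orelse (arm 5 full T [:: 0]) (fun _ =>
  pick T R 1 (fun a ra =>
    let na := minus full ra in
    orelse (arm 4 na T [:: 0; a]) (fun _ =>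
    pick (minus ra T) R 1 (fun c rc => arm 3 (minus na rc) T [:: 0; a; c])))).

Definition find_diamond : option (seq nat) :=
  pick T R 1 (fun a ra =>
    pick (meet T ra) R 1 (fun b rb =>
      orelse (pick (minus (meet ra rb) T) R 1 (fun c _ => Some [:: 0; a; b; c]))
      (fun _ => pick (minus (meet T rb) ra) R 1
        (fun c _ => if a == c then None else Some [:: a; 0; b; c])))).

Definition find_K4 : option (seq nat) :=
  pick T R 1 (fun a ra =>
    pick (meet T ra) R 1 (fun b rb =>
      pick (meet (meet T ra) rb) R 1 (fun c _ => Some [:: 0; a; b; c]))).

Definition find_C5 : option (seq nat) :=
  pick T R 1 (fun a ra =>
    pick (minus T ra) R 1 (fun b rb =>
      pick (minus (minus ra T) rb) R 1 (fun c rc =>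
        pick (minus (minus (meet rb rc) T) ra) R 1
          (fun d _ => Some [:: 0; a; c; d; b])))).
End Search.

(* The reasons for a vertex outside the current graph to exist: [Deg i], vertex [i] has
   fewer than 6 neighbours so far; [Sep i j], the neighbourhood of [i] is contained in that
   of [j]; [New i], the neighbourhood of [i] is covered by too few cliques. *)
Inductive request := Deg of nat | Sep of nat & nat | New of nat.

(* [Two a b i] colours vertices of the neighbourhood of [i], which is 2-colourable when
   there is no K4, with the two colours [a] and [b]. *)
Inductive code := One of nat | Two of nat & nat & nat.
Coercion One : nat >-> code.

(* [Known w]: the vertices [w] induce an excluded graph. [Dead q]: no type is left for the
   vertex requested by [q]. [Req q cs]: one certificate for each type of that vertex.
   [Split t c c']: a vertex of the [t]-th type exists, or that type is discarded. [Leaf]: a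
   colouring of the graph and of all types; with a nonempty first argument, of those not
   in the maximal clique containing these vertices. *)
Inductive cert :=
  | Known of seq nat
  | Dead of request
  | Req of request & seq cert
  | Split of nat & cert & cert
  | Leaf of seq nat & seq code.

Definition bits (r : row) := [seq i <- iota 0 (size r) | bit r i].

Definition clique_idx (R : seq row) (s : seq nat) :=
  all (fun i => all (fun j => (i == j) || bit (line R i) j) s) s.

(** In a diamond-free graph a neighbourhood is a disjoint union of cliques, so the split at its
    first vertex is the only one to try. *)
Definition two_cliques (R : seq row) (s : seq nat) :=
  if s is a :: _ then
    let p j := (j == a) || bit (line R a) j in
    clique_idx R (filter p s) && clique_idx R (filter (predC p) s)
  else true.

Definition triangle_idx (R : seq row) (s : seq nat) :=
  has (fun a => has (fun b => if bit (line R a) b then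
    has (fun c => bit (line R a) c && bit (line R b) c) s else false) s) s.

Definition fits (R : seq row) (q : request) (T : row) : bool :=
  match q with
  | Deg i => bit T i
  | Sep i j => bit T i && ~~ bit T j
  | New i => bit T i && all (fun j => ~~ bit T j) (bits (line R i))
  end.

(* The vertices known to lie in at least three maximal cliques: none, those in a K4, or all. *)
Inductive mode := Plain | CliqueVertices | NoK4.

(* Conditionals instead of boolean connectives below avoid costly evaluations, as
   [vm_compute] is strict. *)
Section Check.
Variables (F : seq matrix) (m : mode).

Definition hit G o := if o is Some w then occurs F G w else false.

(** Only diamond, K4, P6 and C5 are searched for; the larger members of [F] are met through
    [Known]. *)
Definition bad (G : matrix) (R : seq row) (T : row) : bool :=
  if hit (T :: G) (find_diamond R T) then true else
  if hit (T :: G) (find_K4 R T) then true else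
  if hit (T :: G) (find_path R T) then true else
  hit (T :: G) (find_C5 R T).

Definition extend G R (E : seq row) : seq row :=
  flatten [seq [seq T' <- [:: false :: T; true :: T] | ~~ bad G R T'] | T <- E].

Fixpoint types (G : matrix) : seq row :=
  if G is _ :: G' then extend G (rows G) (types G') else [:: [::]].

Definition forced (R : seq row) (q : request) : bool :=
  match q with
  | Deg i => (i < size R) && (count id (line R i) < 6)
  | Sep i j => [&& i < size R, j < size R, i != j, ~~ bit (line R i) j
                 & all (bit (line R j)) (bits (line R i))]
  | New i =>
    let s := bits (line R i) in
    (i < size R) &&
    (if clique_idx R s then true else
     match m with
     | Plain => false
     | CliqueVertices => triangle_idx R s && two_cliques R s
     | NoK4 => two_cliques R s
     end)
  end.

Definition colours c := match c with One a => [:: a] | Two a b _ => [:: a; b] end.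

(** Neighbours of the same vertex may share an ordered pair of colours, because one 2-colouring of
    that neighbourhood decides which of the two each receives. *)
Definition compatible c d :=
  if has (mem (colours c)) (colours d) then
    match c, d with
    | Two a b i, Two a' b' i' => [&& a == a', b == b' & i == i']
    | _, _ => false
    end
  else true.

Definition legal n (r : row) c :=
  match c with
  | One a => a < n
  | Two a b i => [&& (if m is NoK4 then true else false), a < n, b < n, a != b & bit r i]
  end.

Definition isolated_type (T : row) := all negb T.

(* If the vertices with no neighbour in [G] span an edge, then, as the whole graph is
   connected and has no simplicial vertex, some vertex of another type is adjacent to exactly
   one end of such an edge. It is checked that no type of [E] allows this. *)
Definition isolated_stable (G : matrix) (E : seq row) :=
  all (fun T =>
    if isolated_type T then true else
    let G1 := T :: G in let T1 := true :: nseq (size G) false in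
    if bad G1 (rows G1) T1 then true else
    let G2 := T1 :: G1 in bad G2 (rows G2) (true :: false :: nseq (size G) false)) E.

Definition palette (ks : seq nat) := if ks is [::] then 6 else 3.
Definition complete (ks : seq nat) r := if ks is [::] then false else all (bit r) ks.

(** Types with incompatible codes pass only if vertices of these types are never adjacent: because
    of an excluded graph or, for the type without neighbours in [G], by [isolated_stable]. *)
Definition coloured (G : matrix) (E : seq row) (ks : seq nat) (cs : seq code) :=
  let R := rows G in let n := size G in let e := size E in
  let c i := nth (One 0) cs i in let d t := nth (One 0) cs (n + t) in
  let inKv i := (i \in ks) || complete ks (line R i) in
  [&& (if ks is [::] then true else
       [&& uniq ks, 1 < size ks, all (fun i => i < n) ks & clique_idx R ks]),
      all (fun i => if inKv i then true else legal (palette ks) (line R i) (c i) &&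
        all (fun j => if inKv j then true else
          if bit (line R i) j then compatible (c i) (c j) else true) (iota 0 n)) (iota 0 n),
      all (fun t => let T := nth [::] E t in if complete ks T then true else
        legal (palette ks) T (d t) && all (fun j => if inKv j then true else
          if bit T j then compatible (c j) (d t) else true) (iota 0 n)) (iota 0 e)
    & all (fun s => let S := nth [::] E s in if complete ks S then true else
        all (fun t => let T := nth [::] E t in if complete ks T then true else
          if compatible (d s) (d t) then true else
          if bad (S :: G) (rows (S :: G)) (true :: T) then true else
          if s == t then isolated_type S && isolated_stable G E else false)
        (iota s (e - s))) (iota 0 e)].

(* If [fresh], then [E] lists types over the graph without its first vertex. *)
Fixpoint check (c : cert) (G : matrix) (E : seq row) (fresh : bool) : bool :=
  let R := rows G in
  let full (_ : unit) := if fresh then extend G R E else E in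
  match c with
  | Known w => occurs F G w
  | Dead q => [&& fresh, forced R q & all (fun T => all (fun b =>
      if fits R q (b :: T) then bad G R (b :: T) else true) [:: false; true]) E]
  | Req q cs =>
    let E' := full tt in
    forced R q &&
    (fix alternatives E1 Ts cs {struct cs} :=
      match cs, Ts with
      | c' :: cs', T :: Ts' =>
        check c' (T :: G) E1 true && alternatives (filter (predC1 T) E1) Ts' cs'
      | _, _ => nilp Ts
      end) E' (filter (fits R q) E') cs
  | Split t c1 c2 =>
    let E' := full tt in let T := nth [::] E' t in
    check c1 (T :: G) E' true && check c2 G (filter (predC1 T) E') false
  | Leaf ks cs => coloured G (full tt) ks cs
  end.
End Check.

(** Each graph, once excluded, is available to the certificates after it. *)
Fixpoint chain (F : seq matrix) (m : mode) (l : seq (matrix * cert)) : bool :=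
  if l is (G, c) :: l' then
    if ~~ nilp G && check F m c G (types F G) false then chain (rcons F G) m l' else false
  else true.

(* Each neighbour is given by its position among the later vertices. *)
Definition of_neighbours (l : seq (seq nat)) : matrix :=
  (fix f l := if l is s :: l' then
     let G := f l' in [seq j \in s | j <- iota 0 (size G)] :: G else [::]) l.

(** * The excluded graphs and their certificates *)

Definition P6 := of_neighbours [:: [:: 0]; [:: 0]; [:: 0]; [:: 0]; [:: 0]; [::]].
Definition Diamond := of_neighbours [:: [:: 0; 1]; [:: 0; 1]; [:: 0]; [::]].
Definition K3 := of_neighbours [:: [:: 0; 1]; [:: 0]; [::]].
Definition K4 := of_neighbours [:: [:: 0; 1; 2]; [:: 0; 1]; [:: 0]; [::]].
Definition C5 := of_neighbours [:: [:: 0; 3]; [:: 0]; [:: 0]; [:: 0]; [::]].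
(** A C5, on the last five vertices, and a K4 that share exactly one edge. In [K4_across_C5] a
    vertex of the K4 is moreover adjacent to the vertex of the C5 opposite to this edge. *)
Definition K4_on_C5 := of_neighbours
  [:: [:: 0; 4; 5]; [:: 3; 4]; [:: 0; 3]; [:: 0]; [:: 0]; [:: 0]; [::]].
Definition K4_across_C5 := of_neighbours
  [:: [:: 0; 2; 4; 5]; [:: 3; 4]; [:: 0; 3]; [:: 0]; [:: 0]; [:: 0]; [::]].

(* Lets the coercion [One] apply inside list literals. *)
Local Arguments cons {T} & _ _.

(* The certificates were found by computer search. *)

(** The last graph listed is a K4 and a C5 with a single common vertex. *)
Definition chain_K4_C5 : seq (matrix * cert) := [::
  (K4_across_C5,
   Split 2 (Dead (Sep 5 1)) (Split 6 (Dead (Sep 5 1)) (Split 6 (Dead (Sep 3 1)) (Split 10 (Dead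
   (Sep 3 1)) (Split 5 (Req (Deg 5) [:: Dead (New 3); Dead (Deg 6)]) (Split 7 (Leaf [:: 7; 6; 2;
   1] [:: 1; 0; 0; 0; 1; 0; 0; 0; 0; 0; 0; 0; 0; 0; 1; 1; 1; 1; 0; 1; 0; 1; 1; 0]) (Split 12
   (Req (New 2) [:: Leaf [:: 8; 7; 3; 2] [:: 1; 0; 0; 0; 1; 0; 1; 0; 0; 0; 1; 1; 1; 1; 0; 0; 0;
   1; 1; 0; 0; 0]]) (Split 8 (Req (New 2) [:: Dead (Sep 1 3)]) (Split 14 (Req (New 2) [:: Leaf
   [:: 8; 7; 3; 2] [:: 1; 0; 0; 0; 1; 0; 1; 0; 0; 0; 1; 1; 1; 1; 0; 0; 0; 1; 1; 0; 0]]) (Split 3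
   (Split 3 (Dead (New 0)) (Split 6 (Dead (New 1)) (Split 8 (Dead (New 1)) (Split 8 (Dead (Sep 4
   0)) (Split 9 (Dead (Sep 4 2)) (Split 7 (Dead (Sep 6 0)) (Req (New 2) [:: Split 3 (Dead (Sep 7
   3)) (Split 3 (Dead (Sep 1 0)) (Split 5 (Leaf [:: 9; 8; 4; 3] [:: 1; 0; 0; 0; 0; 0; 1; 0; 0;
   0; 0; 0; 0; 1; 1; 1; 1; 0]) (Req (Sep 4 2) [:: Split 6 (Leaf [:: 10; 9; 5; 4] [:: 0; 0; 1; 1;
   0; 0; 1; 0; 1; 0; 0; 0; 1; 1; 1; 0; 0; 0; 0; 0]) (Split 1 (Req (Sep 0 3) [:: Leaf [:: 11; 10;
   6; 5] [:: 0; 1; 0; 1; 1; 0; 0; 1; 0; 1; 0; 0; 1; 1; 1; 1; 0; 0; 0; 0]]) (Req (Sep 0 6) [::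
   Leaf [:: 10; 9; 5; 4] [:: 1; 0; 1; 1; 0; 0; 1; 0; 1; 0; 0; 0; 2; 1; 2; 0; 0; 0;
   0]]))])))]))))))) (Split 6 (Req (Deg 3) [:: Dead (Deg 4)]) (Split 9 (Req (New 2) [:: Dead
   (Sep 1 3)]) (Split 8 (Req (New 2) [:: Dead (Sep 0 2)]) (Split 8 (Dead (Sep 3 0)) (Split 9
   (Req (New 2) [:: Dead (Sep 4 1)]) (Split 7 (Dead (Sep 5 0)) (Req (New 1) [:: Split 3 (Dead
   (Sep 6 2)) (Split 3 (Dead (Sep 1 0)) (Split 5 (Dead (Deg 5)) (Split 6 (Dead (Deg 5)) (Split 5
   (Leaf [:: 8; 7; 3; 2] [:: 1; 0; 0; 0; 0; 1; 0; 0; 0; 0; 0; 0; 1; 1; 1; 1; 0]) (Req (Sep 3 1)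
   [:: Split 6 (Leaf [:: 9; 8; 4; 3] [:: 1; 1; 0; 0; 0; 0; 1; 0; 0; 0; 0; 0; 0; 0; 1; 1; 1; 0;
   0]) (Split 1 (Split 1 (Req (Sep 1 0) [:: Req (Sep 1 2) [:: Split 1 (Dead (Sep 0 7)) (Req (Deg
   3) [:: Split 2 (Dead (Sep 6 1)) (Req (Sep 10 2) [::])])]]) (Split 5 (Req (Sep 7 0) [:: Dead
   (Sep 3 1)]) (Req (Deg 0) [:: Split 1 (Dead (Sep 3 1)) (Leaf [:: 10; 9; 5; 4] [:: 0; 1; 0; 1;
   0; 0; 1; 0; 1; 0; 0; 1; 1; 1; 1; 0; 0; 0; 0; 0; 0])]))) (Req (Sep 0 5) [:: Leaf [:: 9; 8; 4;
   3] [:: 1; 0; 1; 0; 0; 1; 0; 1; 0; 0; 0; 2; 1; 2; 0; 0; 0; 0]]))])))))])))))))))))))))));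
  (K4_on_C5,
   Split 8 (Known [:: 1; 2; 3; 0; 5; 6; 7]) (Split 8 (Known [:: 2; 1; 3; 0; 5; 6; 7]) (Split 5
   (Dead (Deg 5)) (Split 5 (Dead (Deg 5)) (Split 7 (Dead (Deg 3)) (Req (New 0) [:: Split 10
   (Known [:: 7; 3; 4; 0; 1; 2; 8]) (Split 13 (Known [:: 7; 3; 4; 0; 1; 2; 8]) (Split 15 (Known
   [:: 8; 3; 6; 0; 1; 2; 7]) (Split 15 (Known [:: 8; 3; 6; 0; 1; 2; 7]) (Split 2 (Dead (Deg 4))
   (Split 4 (Dead (Deg 4)) (Split 7 (Dead (Deg 4)) (Req (New 2) [:: Split 2 (Dead (Deg 7))
   (Split 3 (Dead (Sep 2 0)) (Split 8 (Dead (Deg 5)) (Req (Deg 0) [:: Req (Deg 7) [:: Req (Deg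
   8) [:: Split 16 (Dead (Sep 5 0)) (Split 16 (Dead (Sep 4 0)) (Split 17 (Dead (Sep 10 0))
   (Split 17 (Dead (Sep 8 0)) (Req (Deg 9) [:: Split 3 (Req (Sep 0 11) [:: Known [:: 0; 9; 10;
   11; 12; 13; 14]; Known [:: 0; 9; 10; 11; 12; 13; 14]; Known [:: 0; 9; 10; 11; 12; 13; 14]])
   (Split 4 (Req (Sep 0 11) [:: Known [:: 0; 9; 10; 11; 12; 13; 14]; Known [:: 0; 9; 10; 11; 12;
   13; 14]; Known [:: 0; 9; 10; 11; 12; 13; 14]]) (Split 4 (Req (Sep 0 11) [:: Known [:: 0; 9;
   10; 11; 12; 13; 14]; Known [:: 0; 9; 10; 11; 12; 13; 14]; Known [:: 0; 9; 10; 11; 12; 13;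
   14]]) (Split 6 (Req (Sep 0 11) [:: Known [:: 0; 9; 10; 11; 12; 13; 14]; Known [:: 0; 9; 10;
   11; 12; 13; 14]; Known [:: 0; 9; 10; 11; 12; 13; 14]]) (Split 6 (Req (Sep 0 11) [:: Known [::
   0; 9; 10; 11; 12; 13; 14]; Known [:: 0; 9; 10; 11; 12; 13; 14]; Known [:: 0; 9; 10; 11; 12;
   13; 14]]) (Split 7 (Req (Sep 0 11) [:: Known [:: 0; 9; 10; 11; 12; 13; 14]; Known [:: 0; 9;
   10; 11; 12; 13; 14]; Known [:: 0; 9; 10; 11; 12; 13; 14]]) (Split 11 (Req (Sep 0 11) [::
   Known [:: 0; 9; 10; 5; 12; 13; 14]; Known [:: 0; 9; 10; 5; 12; 13; 14]; Known [:: 0; 9; 10;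
   11; 12; 13; 14]]) (Split 11 (Req (Sep 0 11) [:: Known [:: 0; 9; 10; 5; 12; 13; 14]; Known [::
   0; 9; 10; 5; 12; 13; 14]; Known [:: 0; 9; 10; 11; 12; 13; 14]]) (Split 12 (Req (Sep 0 11) [::
   Known [:: 0; 9; 10; 5; 12; 13; 14]; Known [:: 0; 9; 10; 5; 12; 13; 14]; Known [:: 0; 9; 10;
   11; 12; 13; 14]]) (Split 15 (Req (Sep 0 11) [:: Known [:: 0; 9; 10; 4; 12; 13; 14]; Known [::
   0; 9; 10; 5; 12; 13; 14]; Known [:: 0; 9; 10; 11; 12; 13; 14]]) (Split 4 (Req (Sep 0 11) [::
   Known [:: 0; 9; 10; 11; 12; 13; 14]; Known [:: 0; 9; 10; 11; 12; 13; 14]; Known [:: 0; 9; 10;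
   11; 12; 13; 14]; Known [:: 0; 9; 10; 11; 12; 13; 14]]) (Split 5 (Req (Sep 0 11) [:: Known [::
   0; 9; 10; 11; 12; 13; 14]; Known [:: 0; 9; 10; 11; 12; 13; 14]; Known [:: 0; 9; 10; 11; 12;
   13; 14]; Known [:: 0; 9; 10; 11; 12; 13; 14]]) (Split 5 (Req (Sep 0 11) [:: Known [:: 0; 9;
   10; 11; 12; 13; 14]; Known [:: 0; 9; 10; 11; 12; 13; 14]; Known [:: 0; 9; 10; 11; 12; 13;
   14]; Known [:: 0; 9; 10; 11; 12; 13; 14]]) (Req (Sep 0 9) [:: Req (Sep 0 11) [:: Dead (New
   1); Known [:: 0; 9; 10; 11; 12; 13; 14]; Known [:: 0; 9; 10; 11; 12; 13; 14]]; Req (Sep 0 11)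
   [:: Known [:: 0; 9; 10; 11; 12; 13; 14]; Known [:: 0; 9; 10; 11; 12; 13; 14]; Known [:: 0; 9;
   10; 11; 12; 13; 14]; Known [:: 0; 9; 10; 11; 12; 13; 14]; Known [:: 0; 9; 10; 11; 12; 13;
   14]]; Known [:: 0; 8; 9; 1; 11; 12; 13]; Known [:: 0; 8; 9; 2; 11; 12; 13]; Known [:: 0; 8;
   9; 3; 11; 12; 13]; Known [:: 0; 8; 9; 3; 11; 12; 13]; Known [:: 0; 8; 9; 4; 11; 12; 13];
   Known [:: 0; 8; 9; 4; 11; 12; 13]; Known [:: 0; 8; 9; 4; 11; 12; 13]; Known [:: 0; 8; 9; 4;
   11; 12; 13]])))))))))))))]))))]]; Dead (Deg 1)])))])))))))]))))));
  (of_neighbours [:: [:: 0; 1; 6]; [:: 0; 5]; [:: 4]; [:: 0; 3]; [:: 0]; [:: 0]; [:: 0]; [::]],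
   Req (New 2) [:: Known [:: 1; 2; 7; 6; 0; 3; 8]; Known [:: 1; 2; 7; 6; 0; 3; 8]; Known [:: 1;
   2; 4; 5; 0; 3; 8]; Dead (New 2); Dead (New 2)])].

Definition chain_K4 : seq (matrix * cert) := [::
  (K4,
   Req (New 3) [:: Split 9 (Split 3 (Split 1 (Dead (New 3)) (Split 5 (Dead (New 6)) (Split 5
   (Dead (New 6)) (Req (New 1) [:: Req (Sep 1 7) [:: Dead (New 2)]])))) (Split 5 (Dead (New 3))
   (Split 7 (Dead (New 4)) (Split 10 (Req (New 0) [:: Dead (New 6)]) (Split 3 (Req (New 5) [::
   Known [:: 7; 5; 1; 2; 0; 6; 4]; Dead (New 6); Known [:: 4; 5; 2; 1; 0; 6; 7]]) (Req (New 2)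
   [:: Req (Deg 1) [:: Known [:: 5; 6; 2; 0; 1; 4; 7]; Known [:: 4; 6; 3; 1; 0; 5; 7]; Known [::
   4; 5; 3; 1; 0; 6; 7]]])))))) (Split 3 (Split 8 (Known [:: 3; 5; 2; 1; 0; 4; 6]) (Split 8
   (Known [:: 6; 5; 1; 2; 0; 4; 3]) (Split 10 (Known [:: 3; 4; 2; 1; 0; 5; 6]) (Split 10 (Known
   [:: 6; 4; 1; 2; 0; 5; 3]) (Split 5 (Req (New 5) [:: Dead (New 6)]) (Split 6 (Req (New 0) [::
   Known [:: 4; 6; 3; 0; 1; 5; 7]; Known [:: 6; 4; 3; 0; 1; 5; 7]]) (Req (New 3) [:: Dead (New
   4)]))))))) (Split 4 (Split 5 (Known [:: 4; 5; 2; 1; 0; 3; 6]) (Split 9 (Known [:: 4; 3; 2; 1;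
   0; 5; 6]) (Split 9 (Known [:: 6; 3; 1; 2; 0; 5; 4]) (Split 1 (Dead (New 3)) (Split 1 (Dead
   (New 3)) (Split 4 (Dead (New 3)) (Req (New 2) [:: Req (Sep 0 5) [:: Known [:: 5; 6; 3; 0; 1;
   4; 7]; Dead (New 1)]]))))))) (Split 5 (Req (New 3) [:: Req (Sep 0 3) [:: Known [:: 4; 6; 3;
   0; 1; 5; 7]; Dead (New 1)]; Known [:: 5; 3; 2; 1; 0; 4; 6]]) (Split 2 (Split 3 (Known [:: 4;
   5; 2; 0; 1; 3; 6]) (Split 1 (Dead (New 2)) (Split 5 (Dead (New 2)) (Split 6 (Dead (New 2))
   (Split 3 (Req (Deg 2) [:: Dead (New 2)]) (Req (Sep 0 5) [::])))))) (Req (New 1) [::])))))])].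

(** Every graph listed is a C5, on its last five vertices, with at most two further vertices. The
    bare C5 comes last because branches of its case tree stop at the others. *)
Definition chain_C5 : seq (matrix * cert) := [::
  (of_neighbours [:: [:: 1; 3; 4]; [:: 0; 1]; [:: 0; 3]; [:: 0]; [:: 0]; [:: 0]; [::]],
   Leaf [::] [:: 2; 1; 3; 0; 1; 3; 0; 0; Two 0 1 0; Two 1 4 2; 1; Two 1 4 3; 0; 2; Two 1 4 5; 0;
   0; 5; 3; 3; 4; 2; 1; 4]);
  (of_neighbours [:: [:: 1; 3; 5]; [:: 0; 1]; [:: 0; 3]; [:: 0]; [:: 0]; [:: 0]; [::]],
   Leaf [::] [:: 2; 0; 3; 4; 0; 2; 0; 0; Two 0 1 0; Two 0 1 2; Two 0 1 3; 4; 2; 0; 5; 0; 1; 3;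
   4; 3; 3; 4; 2; 1]);
  (of_neighbours [:: [:: 0; 2; 3]; [:: 0]; [:: 0; 3]; [:: 0]; [:: 0]; [:: 0]; [::]],
   Leaf [::] [:: 0; 1; 0; 2; 1; 0; 1; 0; 1; Two 0 1 3; 0; 2; 2; 3; 1; 4; 3; 2; 5; 2; 0; 0; 2; 2;
   3; 3]);
  (of_neighbours [:: [:: 0; 3; 5]; [:: 0; 1]; [:: 0; 3]; [:: 0]; [:: 0]; [:: 0]; [::]],
   Leaf [::] [:: 3; 1; 3; 0; 1; 2; 0; 0; Two 0 1 0; 1; 1; 0; 2; 2; 0; 0; 0; 1; 1; 0; 3; 3; 1; 2;
   4; 2; 2; 3]);
  (of_neighbours [:: [:: 2; 3; 5]; [:: 0]; [:: 0; 3]; [:: 0]; [:: 0]; [:: 0]; [::]],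
   Leaf [::] [:: 2; 1; 2; 3; 1; 2; 0; 1; Two 1 3 0; Two 1 3 2; 0; 0; Two 0 1 3; 0; 2; 0; 0; 5;
   5; 5; 1; 5; Two 2 3 6; 3; 3; 4; 4; 2; 2; 4; 4]);
  (of_neighbours [:: [:: 1; 4]; [:: 0; 1]; [:: 0; 3]; [:: 0]; [:: 0]; [:: 0]; [::]],
   Req (Sep 6 0) [:: Known [:: 0; 2; 3; 4; 5; 6; 7]; Dead (New 7); Known [:: 7; 4; 3; 2; 0; 6;
   1]; Known [:: 7; 2; 3; 4; 0; 6; 1]]);
  (of_neighbours [:: [:: 0; 1]; [:: 0]; [:: 0; 3]; [:: 0]; [:: 0]; [:: 0]; [::]],
   Split 21 (Known [:: 0; 2; 3; 4; 5; 6; 7]) (Split 21 (Known [:: 0; 2; 3; 4; 5; 6; 7]) (Split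
   21 (Known [:: 0; 1; 3; 4; 5; 6; 7]) (Split 21 (Known [:: 0; 2; 3; 7; 6; 5; 4]) (Split 21
   (Known [:: 0; 2; 3; 7; 6; 5; 4]) (Split 21 (Known [:: 0; 1; 3; 7; 6; 5; 4]) (Split 10 (Dead
   (New 2)) (Split 10 (Dead (New 1)) (Split 1 (Dead (New 1)) (Split 2 (Dead (New 1)) (Split 8
   (Dead (New 2)) (Split 8 (Dead (New 2)) (Split 9 (Dead (New 2)) (Split 7 (Req (Deg 2) [::
   Known [:: 1; 2; 4; 3; 0; 7; 8]; Known [:: 1; 2; 4; 3; 0; 6; 5]]) (Split 12 (Req (Deg 2) [::
   Known [:: 1; 2; 4; 3; 0; 7; 8]; Known [:: 1; 2; 4; 3; 0; 6; 5]]) (Leaf [::] [:: 2; 1; Two 4 5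
   6; 2; 0; Two 4 5 6; 0; 0; Two 0 1 3; 2; 3; 0; 0; 0; Two 4 5 6; Two 4 5 6; Two 4 5 6; Two 4 5
   6; Two 4 5 6]))))))))))))))));
  (of_neighbours [:: [:: 0; 3; 4]; [:: 0]; [:: 0; 3]; [:: 0]; [:: 0]; [:: 0]; [::]],
   Req (New 5) [:: Known [:: 6; 0; 2; 1; 5; 4; 3]; Known [:: 7; 1; 6; 5; 4; 3; 0]; Known [:: 7;
   1; 6; 5; 4; 3; 0]; Known [:: 6; 0; 4; 5; 1; 2; 3]; Known [:: 0; 6; 5; 1; 2; 3; 4]; Known [::
   7; 5; 6; 1; 2; 3; 0]]);
  (of_neighbours [:: [:: 1; 3; 4]; [:: 0]; [:: 0; 3]; [:: 0]; [:: 0]; [:: 0]; [::]],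
   Leaf [::] [:: Two 4 5 2; Two 4 5 2; Two 2 3 0; Two 4 5 2; Two 2 3 0; Two 2 3 0; Two 4 5 2; 0;
   Two 2 3 0; Two 4 5 2; Two 2 3 0; Two 4 5 2; Two 0 1 3; Two 2 3 0; Two 4 5 2; 0; Two 4 5 2;
   Two 4 5 2; 0; 0; Two 4 5 2; Two 4 5 2; 0; 0; Two 4 5 2; Two 0 1 6; Two 2 3 0; Two 4 5 2; 0;
   Two 2 3 0; 0; Two 2 3 0; 1; 1; Two 4 5 2; 1; 1; 1; 1; 1]);
  (of_neighbours [:: [:: 0; 1]; [:: 0; 3]; [:: 0]; [:: 0]; [:: 0]; [::]],
   Split 3 (Known [:: 1; 0; 4; 3; 2; 6; 5]) (Split 5 (Known [:: 2; 6; 5; 4; 3; 1; 0]) (Split 5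
   (Known [:: 6; 1; 2; 3; 4; 5; 0]) (Leaf [::] [:: 0; 3; 2; 0; 3; 0; 0; Two 0 1 1; Two 0 1 2; 2;
   Two 0 1 4; 5; 2; 2; 2; 4; 3; 4; 4; 2; 3; 2; 4; 4]))));
  (of_neighbours [:: [:: 0; 1; 2; 4]; [::]; [:: 0; 3]; [:: 0]; [:: 0]; [:: 0]; [::]],
   Split 6 (Known [:: 1; 0; 5; 4; 3; 7; 6]) (Split 9 (Known [:: 0; 5; 4; 3; 7; 6]) (Split 9
   (Known [:: 1; 0; 6; 5; 4; 3; 7]) (Split 14 (Known [:: 0; 6; 5; 4; 3; 7]) (Split 16 (Known [::
   1; 0; 7; 3; 4; 5; 6]) (Split 17 (Known [:: 0; 7; 3; 4; 5; 6]) (Split 20 (Known [:: 1; 3; 4;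
   5; 0; 7]) (Split 23 (Known [:: 0; 6; 7; 3; 4; 5]) (Split 3 (Leaf [::] [:: 1; 2; 0; 3; 1; 0;
   1; 0; 5; Two 2 3 0; Two 0 1 1; Two 4 5 2; Two 0 1 3; Two 0 5 4; 5; 2; 4; 2; 3; 2; 2; 4; 1; 3;
   4; 3; 3; 4]) (Split 13 (Leaf [::] [:: 0; 3; 0; 1; 0; 3; 2; 0; 3; Two 0 1 1; 2; 3; Two 2 3 3;
   Two 2 3 4; 1; 1; 0; 2; 0; 0; 1; 4; 1; 3; 3; 4; 2; 4; 4]) (Split 21 (Leaf [::] [:: 0; 3; 0; 0;
   1; 0; 4; 2; 3; Two 0 1 1; 2; 3; Two 3 4 3; 1; Two 2 3 4; 2; 1; 3; 3; 0; 1; 0; 1; 0; 4; 4; 4;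
   3]) (Split 2 (Leaf [::] [:: 2; 2; 0; 3; 5; 0; 1; 0; 2; Two 0 1 1; 5; Two 2 3 2; 1; Two 0 1 3;
   Two 0 1 4; 3; 1; 4; 2; 5; 4; 4; 4; 4; 5; 1; 3; 2; 3; 4; 4]) (Leaf [::] [:: 0; Two 4 5 0; Two
   4 5 0; Two 4 5 0; 1; Two 4 5 0; 0; 0; Two 4 5 0; Two 0 1 2; Two 0 1 3; Two 4 5 0; 0; 0; Two 4
   5 0; 2; 2; 3; 3; 2; Two 4 5 0; 1; 1; Two 4 5 0; Two 4 5 0; 2; 3; 2])))))))))))));
  (of_neighbours [:: [:: 0; 1; 3]; [:: 0; 3]; [:: 0]; [:: 0]; [:: 0]; [::]],
   Split 1 (Known [:: 1; 0; 2; 3; 4; 5; 6]) (Split 3 (Known [:: 1; 0; 4; 3; 2; 6; 5]) (Split 5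
   (Known [:: 0; 4; 3; 2; 6; 5]) (Split 5 (Known [:: 1; 0; 5; 4; 3; 2; 6]) (Split 8 (Known [::
   0; 5; 4; 3; 2; 6]) (Split 9 (Known [:: 1; 0; 6; 2; 3; 4; 5]) (Split 10 (Known [:: 0; 6; 2; 3;
   4; 5]) (Split 11 (Known [:: 1; 2; 3; 4; 0; 6]) (Leaf [::] [:: Two 2 3 1; Two 4 5 2; Two 2 3
   1; Two 4 5 2; 0; Two 2 3 1; 0; Two 2 3 1; Two 4 5 2; 0; Two 2 3 1; 1; Two 2 3 1; Two 4 5 2;
   Two 2 3 1; 1; Two 4 5 2; 1; Two 2 3 1; Two 4 5 2; 1; Two 4 5 2])))))))));
  (C5,
   Split 3 (Known [:: 0; 1; 2; 3; 4; 5]) (Split 5 (Known [:: 0; 3; 2; 1; 5; 4]) (Split 8 (Known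
   [:: 0; 1; 2; 3; 4; 5]) (Split 8 (Known [:: 0; 4; 3; 2; 1; 5]) (Split 8 (Known [:: 0; 4; 3; 2;
   1; 5]) (Split 9 (Known [:: 0; 5; 1; 2; 3; 4]) (Split 11 (Known [:: 0; 5; 1; 2; 3; 4]) (Split
   11 (Known [:: 0; 3; 2; 1; 5; 4]) (Split 11 (Known [:: 0; 4; 5; 1; 2; 3]) (Split 11 (Known [::
   0; 4; 5; 1; 2; 3]) (Split 1 (Split 2 (Known [:: 1; 0; 2; 3; 4; 5; 6]) (Split 5 (Known [:: 1;
   2; 0; 4; 5; 6]) (Split 7 (Known [:: 1; 2; 0; 5; 4; 3]) (Split 1 (Split 2 (Known [:: 1; 0; 3;
   4; 5; 6; 7]) (Split 5 (Known [:: 1; 3; 0; 5; 6; 7]) (Split 7 (Known [:: 1; 3; 0; 6; 5; 4])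
   (Req (Sep 1 0) [:: Leaf [::] [:: 3; 0; 0; 3; 1; 0; 1; 0; 0; Two 0 1 0; Two 0 1 3; 0; Two 0 4
   4; 0; 2; 2; 2; 2; 0; 4; Two 1 5 7; 1; 3; 3; 3; 3; 1; 5]])))) (Split 10 (Dead (Sep 2 0))
   (Split 2 (Leaf [::] [:: 1; 0; Two 4 5 3; 0; Two 4 5 3; 1; 0; 2; Two 4 5 3; 3; 1; 0; 2; 0; 0;
   Two 4 5 3; Two 4 5 3; Two 4 5 3; 2; Two 4 5 3; 3; 3; 3]) (Split 3 (Leaf [::] [:: 2; 0; Two 4
   5 6; 0; 1; Two 4 5 6; 0; 1; 1; 0; 0; 3; 2; 0; 1; 1; 3; Two 4 5 6; Two 4 5 6; Two 4 5 6; Two 4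
   5 6; Two 4 5 6]) (Req (Sep 0 5) [:: Split 3 (Known [:: 0; 1; 4; 3; 7; 6]) (Split 6 (Known [::
   1; 6; 0; 3; 4; 5]) (Split 11 (Known [:: 1; 4; 0; 7; 6; 5]) (Split 13 (Known [:: 2; 1; 0; 7;
   3; 4]) (Req (Sep 1 3) [:: Leaf [::] [:: 1; 0; 2; 4; 1; 0; 1; 0; 1; 3; 3; 1; 1; 3; 2; 0; 0; 0;
   0; 2; 2; 3; 2; 3; 4; 1]]))))])))))))) (Split 1 (Leaf [::] [:: Two 2 3 2; Two 2 3 2; Two 4 5
   3; Two 2 3 2; Two 4 5 3; 1; 0; Two 2 3 2; Two 2 3 2; Two 4 5 3; Two 4 5 3; Two 4 5 3; 0; 1;
   1; Two 2 3 2; Two 2 3 2; 0; Two 2 3 2; Two 2 3 2; Two 4 5 3; Two 4 5 3]) (Split 1 (Leaf [::]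
   [:: Two 2 3 3; 0; Two 2 3 3; Two 4 5 4; Two 2 3 3; Two 4 5 4; 0; Two 2 3 3; Two 2 3 3; Two 2
   3 3; Two 2 3 3; Two 4 5 4; Two 4 5 4; Two 4 5 4; Two 4 5 4; Two 4 5 4; 0; 1; 1; Two 2 3 3;
   Two 2 3 3]) (Leaf [::] [:: Two 4 5 4; 0; Two 2 3 3; Two 4 5 4; Two 2 3 3; 0; 1; Two 2 3 3;
   Two 2 3 3; Two 2 3 3; Two 4 5 4; Two 4 5 4; Two 4 5 4]))))))))))))))].

Definition chain_K3 : seq (matrix * cert) := [::
  (K3,
   Req (Deg 2) [:: Split 7 (Split 4 (Leaf [::] [:: 2; 3; 0; 3; 0; 2; 4; Two 0 1 0; Two 0 1 1; 0;
   Two 0 1 3; 0; 2; 1; 1; 2; Two 0 1 5; 3]) (Split 4 (Leaf [::] [:: 2; 0; 3; 3; 0; 2; 4; Two 0 1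
   0; Two 0 1 2; 0; Two 0 1 3; 0; 2; 2; 1; Two 0 1 5; 3]) (Split 5 (Dead (New 3)) (Split 5 (Dead
   (New 3)) (Req (Deg 3) [:: Split 1 (Dead (New 3)) (Split 4 (Dead (New 3)) (Req (Sep 0 5) [::
   Req (Deg 4) [:: Dead (New 2)]]))]))))) (Split 3 (Split 8 (Leaf [::] [:: 2; 0; 1; 1; 0; 2; 0;
   Two 0 1 0; Two 1 2 1; Two 0 2 2; Two 0 2 3; 2; Two 1 2 4; 1; Two 0 1 5]) (Req (Deg 3) [::
   Leaf [::] [:: 0; 0; 1; 2; 1; 0; 4; 2; Two 0 1 3; 1; 0; Two 0 2 4; 2; Two 2 3 5; 2]])) (Req
   (Deg 1) [:: Split 1 (Dead (Sep 2 4)) (Split 5 (Dead (Sep 2 4)) (Split 5 (Dead (New 1)) (Split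
   3 (Req (Deg 4) [:: Dead (New 2)]) (Req (Sep 0 4) [::]))))]))])].

Lemma chain_K4_C5_ok : chain [:: P6; Diamond] Plain chain_K4_C5.
Proof. by vm_compute. Qed.

Lemma chain_K4_ok : chain ([:: P6; Diamond] ++ map fst chain_K4_C5) CliqueVertices chain_K4.
Proof. by vm_compute. Qed.

Lemma chain_C5_ok : chain [:: P6; Diamond; K4] NoK4 chain_C5.
Proof. by vm_compute. Qed.

Lemma chain_K3_ok : chain [:: P6; Diamond; K4; C5] NoK4 chain_K3.
Proof. by vm_compute. Qed.

(** * Soundness *)

Section Relation.
Variables (V : finType) (e : rel V).
Hypotheses (e_sym : symmetric e) (e_irr : irreflexive e).

Fixpoint adjm (vs : seq V) : matrix :=
  if vs is v :: vs' then map (e v) vs' :: adjm vs' else [::].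

Definition avoids (F : seq matrix) :=
  forall us : seq V, uniq us -> adjm us \notin F.

Lemma size_adjm vs : size (adjm vs) = size vs.
Proof. by elim: vs => //= v vs ->. Qed.

Lemma rows_adjm vs : rows (adjm vs) = [seq map (e v) vs | v <- vs].
Proof.
have consE v us (f : V -> row) :
    cons_col (map (e v) us) (map f us) = [seq e v u :: f u | u <- us].
  by elim: us => //= u us ->.
elim: vs => //= v vs ->; rewrite e_irr consE; congr (_ :: _).
by apply: eq_map => u; rewrite e_sym.
Qed.

Lemma line_adjm x0 vs i :
  i < size vs -> line (rows (adjm vs)) i = map (e (nth x0 vs i)) vs.
Proof. by move=> lti; rewrite rows_adjm /line (nth_map x0). Qed.

Lemma bit_map (x0 : V) f vs i : i < size vs -> bit (map f vs) i = f (nth x0 vs i).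
Proof. by move=> lti; rewrite /bit (nth_map x0). Qed.

Lemma adj_adjm x0 vs i j :
  i < size vs -> j < size vs -> adj (adjm vs) i j = e (nth x0 vs i) (nth x0 vs j).
Proof.
elim: vs i j => //= v vs IH [|i] [|j] //=; rewrite ?e_irr // ?ltnS.
- by move=> _ ltj; rewrite (bit_map x0).
- by move=> lti _; rewrite (bit_map x0) // e_sym.
exact: IH.
Qed.

Lemma sub_adjm x0 vs w :
  all (fun i => i < size vs) w -> sub (adjm vs) w = adjm (map (nth x0 vs) w).
Proof.
elim: w => //= i w IH /andP[lti ltw]; rewrite IH // -map_comp; congr (_ :: _).
by apply/eq_in_map => j jw /=; rewrite (adj_adjm x0) // (allP ltw).
Qed.

Lemma occursN F vs w : avoids F -> uniq vs -> occurs F (adjm vs) w = false.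
Proof.
move=> avF Uvs; apply/negP; rewrite /occurs size_adjm => /and3P[Uw ltw].
case: vs Uvs ltw => [|x0 vs] Uvs ltw.
  by case: w Uw ltw => //= _ _; have := avF [::] isT => /= /negP.
rewrite (sub_adjm x0) //; apply/negP/avF.
rewrite map_inj_in_uniq // => i j iw jw /eqP.
by rewrite nth_uniq ?(allP ltw) // => /eqP.
Qed.

(* Vertices with distinct rows are distinct, so such a matrix is excluded without
   assuming [uniq]. *)
Lemma absent F G vs : avoids F -> G \in F -> uniq (rows G) -> adjm vs <> G.
Proof.
move=> avF GF UG E; have := avF vs; rewrite E GF => H; move: UG.
by rewrite -E rows_adjm => /map_uniq /H.
Qed.

Lemma avoids_sub F F' : {subset F' <= F} -> avoids F -> avoids F'.
Proof. by move=> sF avF us /avF; apply: contra => /sF. Qed.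

Lemma avoids_cat F F' : avoids F -> avoids F' -> avoids (F ++ F').
Proof. by move=> aF aF' us Uus; rewrite mem_cat negb_or aF ?aF'. Qed.

Lemma badN F R x vs : avoids F -> uniq (x :: vs) ->
  bad F (adjm vs) R (map (e x) vs) = false.
Proof.
move=> avF U; have hitN o : hit F (map (e x) vs :: adjm vs) o = false.
  by case: o => //= w; apply: (@occursN F (x :: vs)).
by rewrite /bad !hitN.
Qed.

Definition covers (E : seq row) vs := forall x, x \notin vs -> map (e x) vs \in E.
(** Leaves open the adjacency to the newest vertex, as is the case right after it is added to
    [vs]. *)
Definition tails (E : seq row) vs := forall x, x \notin vs -> behead (map (e x) vs) \in E.

Lemma extend_covers F R E v vs : avoids F -> uniq (v :: vs) -> tails E (v :: vs) ->
  covers (extend F (adjm (v :: vs)) R E) (v :: vs).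
Proof.
move=> avF Uvs tE x xvs; apply/flatten_mapP; exists (behead (map (e x) (v :: vs))).
  exact: tE.
by rewrite mem_filter badN ?cons_uniq ?xvs //= !inE; case: (e x v); rewrite eqxx ?orbT.
Qed.

Lemma types_covers F vs : avoids F -> uniq vs -> covers (types F (adjm vs)) vs.
Proof.
move=> avF; elim: vs => [|v vs IH] /= Uvs; first by move=> x _; rewrite inE.
apply: extend_covers => // x; rewrite inE negb_or => /andP[_ xvs] /=.
by apply: IH => //; case/andP: Uvs.
Qed.

Lemma bits_map (x0 : V) f vs i :
  i \in bits (map f vs) -> i < size vs /\ f (nth x0 vs i).
Proof.
rewrite mem_filter mem_iota size_map add0n => /and3P[bi _ lti].
by rewrite -(bit_map x0).
Qed.

Definition cliq (s : seq V) := {in s &, forall x y, x != y -> e x y}.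

Lemma clique_idxP x0 vs s : uniq vs -> all (fun i => i < size vs) s ->
  clique_idx (rows (adjm vs)) s -> cliq (map (nth x0 vs) s).
Proof.
move=> Uvs lts cl _ _ /mapP[i iS ->] /mapP[j jS ->] ne.
have lti := allP lts i iS; have ltj := allP lts j jS.
move: (allP (allP cl i iS) j jS); rewrite (line_adjm x0) // (bit_map x0) //.
by case/orP=> // /eqP ij; rewrite ij eqxx in ne.
Qed.

Definition separated v s1 s2 := exists u,
  [/\ e v u, u \notin s1 ++ s2 & all (fun w => ~~ e u w) (s1 ++ s2)].

(** In a diamond-free graph this says that [v] lies in at least three maximal cliques. *)
Definition three_cliques v := forall s1 s2,
  all (e v) (s1 ++ s2) -> cliq s1 -> cliq s2 -> separated v s1 s2.

Section Sound.
Variable m : mode.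
Hypothesis deg6 : forall v (s : seq V), size s < 6 -> exists2 u, e v u & u \notin s.
Hypothesis not_comparable :
  forall u v, u != v -> ~~ e u v -> exists2 w, e u w & ~~ e v w.
Hypothesis not_simplicial : forall v s, all (e v) s -> cliq s -> separated v s [::].
Hypothesis three : match m with
  | Plain => True
  | CliqueVertices => forall v a b c,
      e v a -> e v b -> e v c -> e a b -> e a c -> e b c -> three_cliques v
  | NoK4 => forall v, three_cliques v
  end.
Hypothesis linked : forall A : {set V}, A != set0 -> A != setT ->
  exists x y, [/\ x \in A, y \notin A & e x y].
Hypothesis diamond_free : forall x y a b, x != y -> e a b -> e a x -> e a y ->
  e b x -> e b y -> e x y.
Hypothesis K4_free : m = NoK4 -> forall v a b c,
  e v a -> e v b -> e v c -> e a b -> e a c -> e b c -> False.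
Hypothesis not6 : forall f : V -> nat, (forall x, f x < 6) ->
  exists x y, e x y /\ f x = f y.
Hypothesis not3 : forall (s : seq V) (f : V -> nat), uniq s -> 1 < size s -> cliq s ->
  let out x := (x \notin s) && ~~ all (e x) s in
  (forall x, out x -> f x < 3) -> exists x y, [/\ out x, out y, e x y & f x = f y].

Section Forbidden.
Variable F : seq matrix.
Hypothesis F_free : avoids F.

Lemma forced_new vs q : uniq vs -> vs != [::] -> forced m (rows (adjm vs)) q ->
  exists2 x, x \notin vs & fits (rows (adjm vs)) q (map (e x) vs).
Proof.
case: vs => // x0 vs0; move: (x0 :: vs0) => vs Uvs _.
have szR : size (rows (adjm vs)) = size vs by rewrite rows_adjm size_map.
have newP v u : e v u -> u \notin [seq w <- vs | e v w] -> u \notin vs.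
  by move=> evu; rewrite mem_filter evu.
case: q => [i|i j|i] /=; rewrite ?szR.
- case/andP=> lti; rewrite (line_adjm x0) // => cnt.
  have [|u eu un] := @deg6 (nth x0 vs i) [seq w <- vs | e (nth x0 vs i) w].
    by rewrite size_filter; move: cnt; rewrite count_map.
  by exists u; [apply: newP un|rewrite (bit_map x0) // e_sym].
- case/and5P=> lti ltj ij; rewrite !(line_adjm x0) // (bit_map x0) // => nij /allP sij.
  have [|u eu nu] := @not_comparable (nth x0 vs i) (nth x0 vs j) _ nij.
    by rewrite nth_uniq.
  exists u; last by rewrite !(bit_map x0) // ![e u _]e_sym eu.
  apply: contra nu => uvs; rewrite -index_mem in uvs.
  have := sij (index u vs); rewrite mem_filter mem_iota size_map add0n uvs.
  by rewrite !(bit_map x0) // nth_index -?index_mem // eu => /(_ isT).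
case/andP=> lti; rewrite (line_adjm x0) //; set v := nth x0 vs i.
set s := bits _ => H.
have lts : all (fun j => j < size vs) s.
  by apply/allP=> j /(bits_map x0)[].
have evs : all (e v) (map (nth x0 vs) s).
  by apply/allP=> _ /mapP[j /(bits_map x0)[_ ej] ->].
have sE : [seq w <- vs | e v w] =i map (nth x0 vs) s.
  move=> w; rewrite mem_filter; apply/andP/mapP => [[ew wvs]|[j js ->]].
    exists (index w vs); last by rewrite nth_index.
    by rewrite mem_filter mem_iota size_map add0n index_mem wvs (bit_map x0) ?index_mem //
      nth_index ?ew.
  by have [ltj ej] := bits_map x0 js; rewrite mem_nth.
(* [s1] and [s2] make up the neighbours of [v] in [vs], so a neighbour of [v] separated from both is
   outside [vs]. *)
suff [s1 [s2 [s12 sep]]] : exists s1 s2, map (nth x0 vs) s =i s1 ++ s2 /\ separated v s1 s2.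
  case: sep => u [eu nu /allP au]; exists u.
    by apply: (newP v) => //; rewrite sE s12.
  rewrite (bit_map x0) // -/v e_sym eu /=; apply/allP => j js.
  have [ltj _] := bits_map x0 js.
  by rewrite (bit_map x0) // au // -s12 map_f.
move: H; case: ifP => [cl _|_].
  exists (map (nth x0 vs) s), [::]; split; first by move=> w; rewrite cats0.
  by apply: not_simplicial => //; apply: clique_idxP.
have twoP : two_cliques (rows (adjm vs)) s -> three_cliques v ->
    exists s1 s2, map (nth x0 vs) s =i s1 ++ s2 /\ separated v s1 s2.
  move=> two t3; have: exists p, clique_idx (rows (adjm vs)) (filter p s) /\
     clique_idx (rows (adjm vs)) (filter (predC p) s).
    move: two; rewrite /two_cliques; case: (s) => [_|a s'].
      by exists xpredT.
    by case/andP=> c1 c2; eexists; split; [apply: c1|apply: c2].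
  case=> p [c1 c2]; exists (map (nth x0 vs) (filter p s)), (map (nth x0 vs) (filter (predC p) s)).
  have E : map (nth x0 vs) s =i map (nth x0 vs) (filter p s) ++ map (nth x0 vs) (filter (predC
    p) s).
    by move=> w; rewrite -map_cat; apply/esym/eq_mem_map => j;
      rewrite (perm_mem (permEl (perm_filterC p s))).
  split=> //; apply: t3; first by rewrite -(eq_all_r E).
    by apply: clique_idxP => //; rewrite all_filter; apply/allP=> j /(allP lts) /= ->;
      apply: implybT.
  by apply: clique_idxP => //; rewrite all_filter; apply/allP=> j /(allP lts) /= ->;
    apply: implybT.
move: three; case: (m) => // t3; last by move=> two; apply: twoP.
case/andP=> /hasP[a aS /hasP[b bS]]; have [lta ea] := bits_map x0 aS;
  have [ltb eb] := bits_map x0 bS.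
rewrite !(line_adjm x0) // (bit_map x0) //; case: ifP => // eab /hasP[c cS].
have [ltc ec] := bits_map x0 cS; rewrite !(bit_map x0) // => /andP[eac ebc] two.
by apply: twoP => //; apply: (t3 _ _ _ _ ea eb ec).
Qed.

Lemma bad_absent vs R T x : uniq vs -> x \notin vs -> bad F (adjm vs) R T ->
  map (e x) vs <> T.
Proof. by move=> Uvs xvs bT E; move: bT; rewrite -E badN //= xvs. Qed.

Lemma isolatedE (f : V -> bool) vs :
  isolated_type (map f vs) -> map f vs = nseq (size vs) false.
Proof. by elim: vs => //= v vs IH /andP[/negbTE-> /IH->]. Qed.

(** If [z z'] is an edge, its component among the vertices without neighbours in [vs] is joined to
    some outside [y], which by [spread] is adjacent to all of it. As [z] is not simplicial, it has a
    neighbour [u] not adjacent to [z']. By [spread] again [u] is in the component, so [y], [z], [u],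
    [z'] form a diamond. *)
Lemma isolated_stableP E vs : uniq vs -> vs != [::] -> covers E vs ->
  isolated_stable F (adjm vs) E ->
  forall z z', z \notin vs -> z' \notin vs ->
    isolated_type (map (e z) vs) -> isolated_type (map (e z') vs) -> ~~ e z z'.
Proof.
move=> Uvs ne cE st z z' zvs z'vs iz iz'; apply/negP => ezz'.
pose Z x := (x \notin vs) && isolated_type (map (e x) vs).
have Zz : Z z by rewrite /Z zvs.
have Zz' : Z z' by rewrite /Z z'vs.
have ZN x v : Z x -> v \in vs -> e x v = false.
  by case/andP=> _ /isolatedE E1 vvs; have := map_f (e x) vvs;
    rewrite E1 mem_nseq => /andP[_ /eqP].
(* The check on [E] is used here: first [z1], then [z2], is added to the graph extended by [y]. *)
have spread y z1 z2 : y \notin vs -> ~~ Z y -> Z z1 -> Z z2 -> e y z1 -> e z1 z2 -> e y z2.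
  move=> yvs Zy Z1 Z2 ey1 e12; apply: contraT => ny2; move: Zy; rewrite /Z yvs /= => iy.
  have [z1vs iz1] := andP Z1; have [z2vs iz2] := andP Z2.
  have U1 : uniq (y :: vs) by rewrite /= yvs.
  have n1 : z1 \notin y :: vs by rewrite inE negb_or z1vs andbT; apply: contraTneq ey1 => ->;
    rewrite e_irr.
  have n2 : z2 \notin z1 :: y :: vs.
    rewrite !inE !negb_or z2vs andbT; apply/andP; split; first by apply: contraTneq e12 => ->;
      rewrite e_irr.
    by apply: contraTneq iz2 => ->.
  have := allP st _ (cE y yvs); rewrite (negbTE iy) size_adjm /=.
  case: ifP => [b1 _|_ b2].
    by case: (bad_absent U1 n1 b1); rewrite /= e_sym ey1 (isolatedE iz1).
  have U2 : uniq (z1 :: y :: vs) by rewrite cons_uniq n1.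
  have E1 : adjm (z1 :: y :: vs) = (true :: nseq (size vs) false) :: map (e y) vs :: adjm vs.
    by rewrite /= [e z1 y]e_sym ey1 (isolatedE iz1).
  have := @bad_absent (z1 :: y :: vs) (rows (adjm (z1 :: y :: vs)))
    (true :: false :: nseq (size vs) false) z2 U2 n2.
  rewrite E1 => /(_ b2); case.
  by rewrite /= e_sym e12 e_sym (negbTE ny2) (isolatedE iz2).
pose r x w := [&& Z x, Z w & e x w].
have r_sym : connect_sym r by apply: sym_connect_sym => x w; rewrite /r e_sym andbCA.
pose A := [set x | connect r z x].
have AZ x : x \in A -> Z x.
  rewrite inE => /connectP[p pth ->].
  by case/lastP: p pth => // p w; rewrite rcons_path last_rcons => /andP[_ /and3P[]].
have [||x [y [xA yA exy]]] := @linked A.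
- by apply/set0Pn; exists z; rewrite inE connect0.
- have [v vvs] : exists v, v \in vs by case: (vs) ne => // v ? _; exists v; apply: mem_head.
  by apply/eqP=> AT; have := AZ v; rewrite AT inE /Z vvs => /(_ isT).
have Zx := AZ x xA.
have yvs : y \notin vs by apply: contraL exy => yvs; rewrite (ZN x).
have Zy : ~~ Z y.
  apply: contra yA => Zy; move: xA; rewrite !inE => zx.
  by apply: connect_trans zx (connect1 _); rewrite /r Zx Zy.
have yA' w : w \in A -> e y w.
  rewrite inE => zw.
  have /connectP[p] : connect r x w.
    by apply: connect_trans zw; rewrite r_sym; move: xA; rewrite inE.
  have := exy; rewrite e_sym; elim: p x {Zx xA exy} => [|x' p IH] x /= eyx; first by move=> _ ->.
  case/andP=> /and3P[Zx Zx' exx'] pth wl; apply: (IH x') => //.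
  exact: spread eyx exx'.
have eyz : e y z by apply: yA'; rewrite inE connect0.
have eyz' : e y z' by apply: yA'; rewrite inE connect1 // /r Zz Zz'.
have [||u [ezu]] := @not_simplicial z [:: z'].
- by rewrite /= ezz'.
- by move=> a b; rewrite !inE => /eqP-> /eqP->; rewrite eqxx.
rewrite /= inE => uz' /andP[nuz' _].
have uvs : u \notin vs by apply: contraL ezu => uvs; rewrite (ZN z).
case: (boolP (Z u)) => [Zu|nZu]; last first.
  by rewrite (spread u z z') // e_sym in nuz'.
have eyu : e y u by apply: yA'; rewrite inE connect1 // /r Zz Zu.
by rewrite (diamond_free uz' eyz eyu eyz' ezu ezz') in nuz'.
Qed.

(** Without K4 and diamonds the neighbourhood of [v] induces a matching; the end of larger rank of
    each of its edges is marked. *)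
Definition side v x := [exists y, [&& e v y, e x y & enum_rank y < enum_rank x]].

Lemma sideN v x y : m = NoK4 -> e v x -> e v y -> e x y -> side v x = ~~ side v y.
Proof.
move=> mE; have side_lt a b : e v a -> e v b -> e a b -> side v a = (enum_rank b < enum_rank a).
  move=> eva evb eab; apply/existsP/idP => [[w /and3P[evw eaw]]|lt]; last by exists b;
    rewrite evb eab.
  suff -> : w = b by [].
  apply/eqP; apply: contraT => wb.
  case: (K4_free mE eva evw evb eaw eab).
  exact: (diamond_free wb eva).
move=> evx evy exy; have eyx : e y x by rewrite e_sym.
rewrite (side_lt x y) // (side_lt y x) // -leqNgt ltn_neqAle.
by case: eqP => // /val_inj/enum_rank_inj E; rewrite E e_irr in exy.
Qed.

(** The codes give a proper colouring [col] of all vertices, or of those outside a maximal clique,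
    which [not6] or [not3] refutes. *)
Lemma colouredN E vs ks cs : uniq vs -> vs != [::] -> covers E vs ->
  coloured F m (adjm vs) E ks cs -> False.
Proof.
case: vs => // x0 vs0; move: (x0 :: vs0) (isT : x0 :: vs0 != [::]) => vs ne Uvs _ cE.
rewrite /coloured; cbv beta zeta; rewrite size_adjm.
case/and4P=> Kok /allP Vok /allP Tok /allP Pok.
pose S := map (nth x0 vs) ks.
(* A nonempty [ks] has two adjacent vertices, so in a diamond-free graph [S] and its common
   neighbours form the maximal clique containing [S]. *)
pose out x := if ks is [::] then true else (x \notin S) && ~~ all (e x) S.
pose code_of x := if x \in vs then nth (One 0) cs (index x vs)
                  else nth (One 0) cs (size vs + index (map (e x) vs) E).
pose col x := match code_of x with
  | One a => a
  | Two a b i => if side (nth x0 vs i) x then a else b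
  end.
have SE x : ks != [::] -> all (bit (map (e x) vs)) ks = all (e x) S.
  move=> ks0; rewrite all_map; apply: eq_in_all => i iks /=; rewrite (bit_map x0) //.
  by case: (ks) ks0 Kok iks => // k ks' _ /and4P[_ _ /allP lt _] /lt.
have lineE x : x \in vs -> line (rows (adjm vs)) (index x vs) = map (e x) vs.
  by move=> xvs; rewrite (line_adjm x0) ?index_mem // nth_index.
have outT x : out x -> complete ks (map (e x) vs) = false.
  have := SE x; rewrite /out /complete /S; case: (ks) => // k ks' SEx /andP[_ na].
  by rewrite SEx // (negbTE na).
have outV x : x \in vs -> out x -> (index x vs \in ks) || complete ks (line (rows (adjm vs))
  (index x vs)) = false.
  move=> xvs ox; rewrite lineE // outT // orbF; apply: contraTF ox => iks.
  have xS : x \in S by apply/mapP; exists (index x vs); rewrite ?nth_index.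
  by rewrite /out; case: (ks) iks => // k ks' _; rewrite xS.
have lt_type x : x \notin vs -> index (map (e x) vs) E < size E by move=> xvs;
  rewrite index_mem cE.
have nth_type x : x \notin vs -> nth [::] E (index (map (e x) vs) E) = map (e x) vs.
  by move=> xvs; rewrite nth_index ?cE.
have legalP x : out x -> legal m (palette ks) (map (e x) vs) (code_of x).
  move=> ox; rewrite /code_of; case: ifP => [xvs|/negbT xvs].
    have := Vok (index x vs); rewrite mem_iota index_mem xvs outV // lineE //.
    by move=> /(_ isT) /andP[].
  have := Tok (index (map (e x) vs) E); rewrite mem_iota lt_type // nth_type // outT //.
  by move=> /(_ isT) /andP[].
have mixed x y : x \in vs -> y \notin vs -> out x -> out y -> e x y ->
    compatible (code_of x) (code_of y).
  move=> xvs yvs ox oy exy; rewrite /code_of xvs (negbTE yvs).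
  have := Tok (index (map (e y) vs) E); rewrite mem_iota lt_type // nth_type // outT //.
  move=> /(_ isT) /andP[_ /allP/(_ (index x vs))]; rewrite mem_iota index_mem xvs outV //.
  by rewrite (bit_map x0) ?index_mem // nth_index // e_sym exy => /(_ isT).
have outer x y : x \notin vs -> y \notin vs -> out x -> out y -> e x y ->
    index (map (e x) vs) E <= index (map (e y) vs) E -> compatible (code_of x) (code_of y).
  move=> xvs yvs ox oy exy le; rewrite /code_of (negbTE xvs) (negbTE yvs).
  have := Pok (index (map (e x) vs) E); rewrite mem_iota lt_type // nth_type // outT //.
  move=> /(_ isT)/allP/(_ (index (map (e y) vs) E)).
  rewrite mem_iota le subnKC ?lt_type //; last by rewrite ltnW // lt_type.
  rewrite nth_type // outT // => /(_ isT); case: ifP => // _; case: ifP => [b _|_].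
    have Uxvs : uniq (x :: vs) by rewrite /= xvs.
    have yx : y \notin x :: vs.
      by rewrite inE negb_or yvs andbT; apply: contraTneq exy => ->; rewrite e_irr.
    by case: (bad_absent Uxvs yx b); rewrite /= e_sym exy.
  case: eqP => // eqi /andP[ix st].
  have Txy : map (e x) vs = map (e y) vs by rewrite -(nth_type x) // eqi nth_type.
  have := isolated_stableP Uvs ne cE st xvs yvs ix; rewrite -Txy => /(_ ix).
  by rewrite exy.
have proper x y : out x -> out y -> e x y -> compatible (code_of x) (code_of y) -> col x <> col y.
  move=> ox oy exy; have := legalP x ox; have := legalP y oy; rewrite /col.
  case: (code_of x) (code_of y) => [a|a b i] [a'|a' b' i'] /=; rewrite /compatible /= ?inE ?orbF.
  - by move=> _ _; case: eqP => // ? _; apply: nesym.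
  - by move=> _ _; case: ifP => // /negbT; rewrite negb_or => /andP[/eqP ? /eqP ?] _;
    case: ifP => _; apply: nesym.
  - by move=> _ _; case: ifP => // /negbT; rewrite negb_or => /andP[/eqP ? /eqP ?] _;
    case: ifP => _; apply: nesym.
  case/and5P=> mE' _ _ ab' by' /and5P[_ _ _ ab bx].
  have mE : m = NoK4 by case: (m) mE'.
  have lti : i < size vs.
    by rewrite ltnNge; apply: contraL bx => le; rewrite /bit nth_default ?size_map.
  case: ifP => [_ /and3P[/eqP ea /eqP eb /eqP ei]|].
    move: by' ab bx; rewrite -ei -ea -eb !(bit_map x0) // => ey /eqP ab ex.
    rewrite (@sideN _ x y mE) 1?e_sym // 1?e_sym //.
    by case: (side _ y) => /= E1; apply: ab.
  move=> /negbT; rewrite !negb_or => /andP[/andP[/eqP h1 /eqP h2] /andP[/eqP h3 /eqP h4]] _.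
  by case: ifP => _; case: ifP => _ E1; [apply: h1|apply: h3|apply: h2|apply: h4].
have proper' x y : out x -> out y -> e x y -> col x <> col y.
  move=> ox oy exy; have eyx : e y x by rewrite e_sym.
  case: (boolP (x \in vs)) => xvs; case: (boolP (y \in vs)) => yvs.
  - apply: proper => //; rewrite /code_of xvs yvs.
    have := Vok (index x vs); rewrite mem_iota index_mem xvs outV // lineE //.
    move=> /(_ isT) /andP[_ /allP/(_ (index y vs))]; rewrite mem_iota index_mem yvs outV //.
    by rewrite (bit_map x0) ?index_mem // nth_index // exy => /(_ isT).
  - by apply: proper => //; apply: mixed.
  - by apply: nesym; apply: proper => //; apply: mixed.
  (* The check visits each pair of types in one order only. *)
  case/orP: (leq_total (index (map (e x) vs) E) (index (map (e y) vs) E)) => le.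
    by apply: proper => //; apply: outer.
  by apply: nesym; apply: proper => //; apply: outer.
have small x : out x -> col x < palette ks.
  move=> ox; have := legalP x ox; rewrite /col; case: (code_of x) => //= a b i.
  by case/and5P=> _ la lb _ _; case: ifP.
case: (posnP (size ks)) => [/size0nil ks0|ks_gt].
  have outA x : out x by rewrite /out ks0.
  have [x|x [y [exy E1]]] := @not6 col; first by have := small x (outA x); rewrite ks0.
  exact: proper' E1.
have [Uks ks1 ltks clks] : [/\ uniq ks, 1 < size ks, all (fun i => i < size vs) ks
    & clique_idx (rows (adjm vs)) ks].
  by case: (ks) Kok ks_gt => // k ks' /and4P[].
have NE : palette ks = 3 by rewrite /palette; case: (ks) ks_gt.
have outE x : out x = (x \notin S) && ~~ all (e x) S by rewrite /out; case: (ks) ks_gt.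
have [|||x|x [y [ox oy exy E1]]] := @not3 S col.
- rewrite map_inj_in_uniq // => i j /(allP ltks) lti /(allP ltks) ltj /eqP.
  by rewrite nth_uniq // => /eqP.
- by rewrite size_map.
- exact: clique_idxP.
- by rewrite -outE -NE; apply: small.
by apply: (proper' x y) => //; rewrite outE.
Qed.

Definition admits (fresh : bool) E vs := if fresh then tails E vs else covers E vs.

(** A direct [fix] is used because [Req] nests certificates in a list. *)
Lemma checkN c : forall G E fresh vs, uniq vs -> vs != [::] -> G = adjm vs ->
  admits fresh E vs -> check F m c G E fresh -> False.
Proof.
move: c; fix IH 1; case=> [w|q|q cs|t c1 c2|ks cs] G E fresh vs Uvs ne GE aE; rewrite {G}GE.
- by rewrite /= occursN.
- case/and3P=> fr /(forced_new Uvs ne)[x xvs fx] /allP allb.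
  rewrite fr {fr} in aE; case: vs Uvs ne aE xvs fx allb => // v vs Uvs _ aE xvs fx allb.
  have mb : e x v \in [:: false; true] by case: (e x v).
  have := allP (allb _ (aE x xvs)) _ mb.
  rewrite -[e x v :: _]/(map (e x) (v :: vs)) fx.
  by move/(bad_absent Uvs xvs); apply.
all: have cE : covers (if fresh then extend F (adjm vs) (rows (adjm vs)) E else E) vs.
all: try by case: (fresh) aE => //; case: vs Uvs ne => // v vs Uvs _; apply: extend_covers.
all: rewrite [check _ _ _ _ _ _]/=; move: (if fresh then _ else _) cE => E' {aE}cE.
all: have yes E1 x : covers E1 vs -> x \notin vs -> admits true E1 (x :: vs).
all: try by move=> cE1 xvs y; rewrite inE negb_or => /andP[_ yvs] /=; apply: cE1.
(* The conclusion for [c] is taken as a premise, to be supplied by [IH] at a subterm, so that the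
   [fix] stays guarded. *)
all: have step c x E1 : check F m c (map (e x) vs :: adjm vs) E1 true -> x \notin vs ->
       covers E1 vs -> (forall G E fresh vs, uniq vs -> vs != [::] -> G = adjm vs ->
  admits fresh E vs -> check F m c G E fresh -> False) -> False.
all: try by move=> ch xvs cE1 /(_ _ E1 true (x :: vs)); apply=> //=; rewrite ?xvs //; apply: yes.
- case/andP=> /(forced_new Uvs ne)[x0 x0vs fx0].
  have : exists2 x, x \notin vs & map (e x) vs \in filter (fits (rows (adjm vs)) q) E'.
    by exists x0 => //; rewrite mem_filter fx0 cE.
  move: (filter _ E') => Ts; move: cE.
  elim: cs Ts E' => [|c cs IHcs] [|T Ts] E' cE ex; try by case: ex.
  rewrite /=; case/andP=> ch alt.
  (* If any outside vertex has type [T], not only the requested one, its certificate applies;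
     otherwise [T] is discarded for good. *)
  case: (pickP (fun x => (x \notin vs) && (map (e x) vs == T))) => [x /andP[xvs /eqP xT]|noT].
    by apply: (step c x E') => //; [rewrite xT|apply: IH].
  apply: (IHcs Ts (filter (predC1 T) E')) => //.
    move=> x xvs; rewrite mem_filter cE // andbT /=.
    by have := noT x; rewrite xvs /= => ->.
  by case: ex => x xvs; rewrite inE => /orP[/eqP xT|xTs]; [have := noT x;
    rewrite xvs xT eqxx|exists x].
- case/andP=> ch1 ch2; set T := nth [::] E' t in ch1 ch2.
  case: (pickP (fun x => (x \notin vs) && (map (e x) vs == T))) => [x /andP[xvs /eqP xT]|noT].
    by apply: (step c1 x E') => //; [rewrite xT|apply: IH].
  apply: (IH c2 (adjm vs) (filter (predC1 T) E') false vs) => // x xvs.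
  rewrite mem_filter cE // andbT /=.
  by have := noT x; rewrite xvs /= => ->.
exact: colouredN.
Qed.

End Forbidden.

Lemma chainP F l : avoids F -> chain F m l -> avoids (F ++ map fst l).
Proof.
elim: l F => [|[G c] l IH] F avF /=; first by rewrite cats0.
case: ifP => // /andP[G0 ch] chl; rewrite -cat_rcons; apply: IH => // us Uus.
rewrite mem_rcons inE negb_or avF // andbT; apply/eqP=> GE.
have us0 : us != [::] by apply: contraNneq G0 => us0; rewrite -GE us0.
apply: (@checkN F avF c G (types F G) false us) => //.
by rewrite -GE; apply: types_covers.
Qed.

End Sound.
End Relation.

(** * Minimal non-colourable graphs *)

Section Critical.
Variables (V : finType) (e : rel V) (k : nat).
Hypotheses (e_sym : symmetric e) (e_irr : irreflexive e).
Hypothesis P6_free : avoids e [:: P6].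
Hypothesis diamond_avoided : avoids e [:: Diamond].
Hypothesis k_ge6 : 6 <= k.
Hypothesis small_cliques : forall A : {set V},
  {in A &, forall x y, x != y -> e x y} -> #|A| <= k.

Definition proper (A : {set V}) (c : V -> nat) :=
  (forall x, c x < k) /\ {in A &, forall x y, e x y -> c x != c y}.

Hypothesis critical : forall A : {set V}, A != setT -> exists c, proper A c.
Hypothesis uncolourable : forall c, ~ proper setT c.

Lemma edge_neq x y : e x y -> x != y.
Proof. by apply: contraTneq => ->; rewrite e_irr. Qed.

Lemma diamond_free x y a b :
  x != y -> e a b -> e a x -> e a y -> e b x -> e b y -> e x y.
Proof.
move=> xy eab eax eay ebx eby; apply: contraT => /negbTE nxy.
have := diamond_avoided (us := [:: x; a; b; y]); rewrite /= !inE /= nxy eab eay eby.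
rewrite ![e x _]e_sym eax ebx !negb_or xy !edge_neq //; last by rewrite e_sym.
- by move=> /(_ isT).
- by rewrite e_sym.
Qed.

Lemma no_P6 z0 z1 z2 z3 z4 z5 :
  e z0 z1 -> e z1 z2 -> e z2 z3 -> e z3 z4 -> e z4 z5 ->
  ~~ e z0 z2 -> ~~ e z0 z3 -> ~~ e z0 z4 -> ~~ e z0 z5 ->
  ~~ e z1 z3 -> ~~ e z1 z4 -> ~~ e z1 z5 ->
  ~~ e z2 z4 -> ~~ e z2 z5 -> ~~ e z3 z5 -> False.
Proof.
move=> e01 e12 e23 e34 e45 n02 n03 n04 n05 n13 n14 n15 n24 n25 n35.
apply: (@absent V e e_sym e_irr [:: P6] P6 [:: z0; z1; z2; z3; z4; z5]) => //=.
rewrite e01 e12 e23 e34 e45 (negbTE n02) (negbTE n03) (negbTE n04) (negbTE n05) (negbTE n13).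
by rewrite (negbTE n14) (negbTE n15) (negbTE n24) (negbTE n25) (negbTE n35).
Qed.

Definition nbrs v := [set u | e v u].

(** Otherwise [v] could take colour [a], and the whole graph would be coloured. *)
Lemma extend_at v c a : proper [set~ v] c -> a < k -> exists2 u, e v u & c u = a.
Proof.
case=> ck cP ltak; case: (pickP [pred u | e v u && (c u == a)]) => [u /andP[evu /eqP]|none].
  by exists u.
have na u : e v u -> c u != a by move=> evu; have := none u; rewrite /= evu /= => ->.
pose c' x := if x == v then a else c x.
case: (@uncolourable c'); split=> [x|x y _ _ exy]; rewrite /c'; first by case: eqP.
have [xv|xv] := eqVneq x v.
  have yv : y != v by rewrite -xv eq_sym edge_neq.
  by rewrite (negbTE yv) eq_sym; apply: na; rewrite -xv.
have [yv|yv] := eqVneq y v; last by apply: cP; rewrite ?inE.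
by apply: na; rewrite -yv e_sym.
Qed.

Lemma colour_without v : exists c, proper [set~ v] c.
Proof.
by apply: critical; apply/eqP=> A; have := in_setT v; rewrite -A !inE eqxx.
Qed.

Lemma degree_ge v : k <= #|nbrs v|.
Proof.
have [c pc] := colour_without v; rewrite cardE -(size_map c) -[k]card_ord cardE -(size_map val).
apply: uniq_leq_size; first by rewrite (map_inj_uniq val_inj) enum_uniq.
move=> _ /mapP[a _ ->]; have [u evu /= <-] := extend_at pc (ltn_ord a : val a < k).
by apply: map_f; rewrite mem_enum inE.
Qed.

Lemma degree_gt v (s : seq V) : size s < k -> exists2 u, e v u & u \notin s.
Proof.
move=> lts; case: (pickP [pred u | e v u && (u \notin s)]) => [u /andP[]|none].
  by exists u.
have: nbrs v \subset s by apply/subsetP=> u; rewrite inE => evu; have := none u;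
  rewrite /= evu => /negbFE.
by move/subset_leq_card/leq_trans/(_ (card_size s)); rewrite leqNgt (leq_trans lts) // degree_ge.
Qed.

(** Otherwise [u] could take the colour of [v]. *)
Lemma not_comparable u v : u != v -> ~~ e u v -> exists2 w, e u w & ~~ e v w.
Proof.
move=> uv nuv; case: (pickP [pred w | e u w && ~~ e v w]) => [w /andP[]|none]; first by exists w.
have sub w : e u w -> e v w by move=> euw; have := none w; rewrite /= euw => /negbFE.
have [c [ck cP]] := colour_without u.
have [w euw cw] := extend_at (conj ck cP) (ck v).
have evw := sub w euw.
by have := cP v w; rewrite !inE eq_sym uv eq_sym edge_neq // cw eqxx => /(_ isT isT evw).
Qed.

(** Otherwise colourings of [A] and of its complement combine. *)
Lemma linked (A : {set V}) : A != set0 -> A != setT ->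
  exists x y, [/\ x \in A, y \notin A & e x y].
Proof.
move=> A0 AT; have [c cP] := critical AT.
have CT : ~: A != setT by apply: contraNneq A0 => E; rewrite -[A]setCK E setCT.
have [d dP] := critical CT.
case: (boolP [exists x in A, exists y in ~: A, e x y]) => [|none].
  by case/exists_inP=> x xA /exists_inP[y]; rewrite inE => yA exy; exists x, y.
case: (@uncolourable (fun x => if x \in A then c x else d x)); split=> [x|x y _ _ exy].
  by case: ifP => _; [apply: cP.1|apply: dP.1].
have sepA u w : u \in A -> w \notin A -> e u w -> false.
  move=> uA wA euw; case/negP: none; apply/exists_inP; exists u => //.
  by apply/exists_inP; exists w => //; rewrite inE.
case: ifP => [xA|/negbT xA]; case: ifP => [yA|/negbT yA].
- exact: cP.2.
- by have := sepA _ _ xA yA exy.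
- by have := sepA _ _ yA xA; rewrite e_sym exy => /(_ isT).
by apply: dP.2; rewrite ?inE.
Qed.

(* The maximal clique through the edge [v a], without [v]. *)
Definition petal v a := [set u | e v u && ((u == a) || e a u)].

Lemma petal_clique v a : e v a ->
  {in v |: petal v a &, forall x y, x != y -> e x y}.
Proof.
move=> eva x y; rewrite !inE.
case/orP=> [/eqP->|/andP[evx ax]] /orP[/eqP->|/andP[evy ay]] xy //.
- by rewrite eqxx in xy.
- by rewrite e_sym.
case/orP: ax => [/eqP xa|eax]; case/orP: ay => [/eqP ya|eay].
- by rewrite xa ya eqxx in xy.
- by rewrite xa.
- by rewrite ya e_sym.
exact: (diamond_free xy eva).
Qed.

Lemma petal_card v a : e v a -> #|petal v a| < k.
Proof.
move=> eva; have := small_cliques (petal_clique eva).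
by rewrite cardsU1 !inE e_irr.
Qed.

(** In a diamond-free graph, being equal or adjacent is a transitive relation on the neighbours of
    [v]. *)
Lemma petal_absorb v a s u : all (e v) s -> cliq e s -> a \in s -> e v u ->
  (u \in s) || ~~ all (fun w => ~~ e u w) s -> u \in petal v a.
Proof.
move=> /allP evs cl aS evu; rewrite inE evu /=.
case/orP=> [uS|]; first by have [//|/= ua] := eqVneq u a; apply: cl; rewrite // eq_sym.
case/allPn=> w wS; rewrite negbK => euw; have [//|/= ua] := eqVneq u a.
have [<-|aw] := eqVneq w a; first by rewrite e_sym.
rewrite e_sym; apply: (diamond_free ua (evs w wS) evu (evs a aS)); first by rewrite e_sym.
exact: cl.
Qed.

Lemma absorbed v s : all (e v) s -> cliq e s -> s != [::] -> exists2 a, e v a &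
  forall u, e v u -> (u \in s) || ~~ all (fun w => ~~ e u w) s -> u \in petal v a.
Proof.
case: s => // a s evs cl _; exists a; first by case/andP: evs.
by move=> u; apply: petal_absorb (mem_head _ _).
Qed.

(** The petal absorbing [s] has fewer than [k] vertices, while [v] has degree at least [k]. *)
Lemma not_simplicial v s : all (e v) s -> cliq e s -> separated e v s [::].
Proof.
move=> evs cl; have [s0|s_ne] := eqVneq s [::].
  have [|u evu _] := @degree_gt v [::]; first exact: leq_trans k_ge6.
  by exists u; rewrite s0.
have [a eva abs] := absorbed evs cl s_ne.
have : ~~ (nbrs v \subset petal v a).
  by apply: contraL (petal_card eva) => /subset_leq_card le;
    rewrite -leqNgt (leq_trans (degree_ge v)).
case/subsetPn=> u; rewrite inE => evu nu; exists u; split=> //; rewrite cats0.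
  by apply: contra nu => us; apply: abs; rewrite ?us.
by apply: contraR nu => nall; apply: abs; rewrite ?nall ?orbT.
Qed.

(** Each clique is replaced by the petal that absorbs it, which leaves only to show that two petals
    do not cover the neighbours of [v]. *)
Lemma separate v s1 s2 :
  (forall a b, e v a -> e v b -> nbrs v \subset petal v a :|: petal v b -> False) ->
  all (e v) (s1 ++ s2) -> cliq e s1 -> cliq e s2 -> separated e v s1 s2.
Proof.
move=> two; rewrite all_cat => /andP[ev1 ev2] cl1 cl2.
have [s0|s1_ne] := eqVneq s1 [::].
  by rewrite s0; have [u [evu]] := not_simplicial ev2 cl2; rewrite cats0; exists u.
have [s0|s2_ne] := eqVneq s2 [::]; first by rewrite s0; apply: not_simplicial.
have [a eva abs1] := absorbed ev1 cl1 s1_ne; have [b evb abs2] := absorbed ev2 cl2 s2_ne.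
have : ~~ (nbrs v \subset petal v a :|: petal v b) by apply/negP/(two a b).
case/subsetPn=> u uN; rewrite in_setU negb_or => /andP[n1 n2].
have evu : e v u by move: uN; rewrite inE.
exists u; split=> //.
  by rewrite mem_cat negb_or; apply/andP; split;
    [apply: contra n1 => us; apply: abs1|apply: contra n2 => us; apply: abs2]; rewrite ?us.
by rewrite all_cat; apply/andP; split;
  [apply: contraR n1 => na; apply: abs1|apply: contraR n2 => na; apply: abs2]; rewrite ?na ?orbT.
Qed.

Lemma K4_free : avoids e [:: K4] -> forall v a b c,
  e v a -> e v b -> e v c -> e a b -> e a c -> e b c -> False.
Proof.
move=> avK v a b c va vb vc ab ac bc.
apply: (@absent V e e_sym e_irr [:: K4] K4 [:: v; a; b; c]) => //=.
by rewrite va vb vc ab ac bc.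
Qed.

(** Petals now have at most two vertices, so two of them cannot cover six neighbours. *)
Lemma three_NoK4 : avoids e [:: K4] -> forall v, three_cliques e v.
Proof.
move=> /K4_free K4N v s1 s2 ev cl1 cl2; apply: separate => // a b eva evb sub.
have le2 d : e v d -> #|petal v d| <= 2.
  move=> evd; have -> : petal v d = d |: [set u | e v u && e d u].
    by apply/setP=> u; rewrite !inE; have [->|_] := eqVneq u d; rewrite ?evd.
  apply: leq_trans (leq_card_setU _ _) _; rewrite cards1 ltnS leqNgt.
  apply/negP=> /card_gt1P[x [y [xP yP xy]]].
  move: xP yP; rewrite !inE => /andP[vx dx] /andP[vy dy].
  exact: (K4N v d x y evd vx vy dx dy (diamond_free xy evd vx vy dx dy)).
have := leq_trans k_ge6 (leq_trans (degree_ge v) (subset_leq_card sub)).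
rewrite leqNgt => /negP; apply; rewrite ltnS.
apply: leq_trans (leq_card_setU _ _) _.
by apply: leq_trans (leq_add (le2 a eva) (le2 b evb)) _.
Qed.

Lemma not6 (f : V -> nat) : (forall x, f x < 6) -> exists x y, e x y /\ f x = f y.
Proof.
move=> f6; case: (pickP [pred p : V * V | e p.1 p.2 && (f p.1 == f p.2)]) => [[x y]|none].
  by case/andP=> /= exy /eqP; exists x, y.
case: (@uncolourable f); split=> [x|x y _ _ exy]; first exact: leq_trans k_ge6.
by have := none (x, y); rewrite /= exy => /= ->.
Qed.

(* A vertex outside a maximal clique has at most one neighbour in it, so each of the
   three colour classes outside can be recoloured with two of the clique's colours. *)
Lemma not3 (s : seq V) (f : V -> nat) : uniq s -> 1 < size s -> cliq e s ->
  let out x := (x \notin s) && ~~ all (e x) s in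
  (forall x, out x -> f x < 3) -> exists x y, [/\ out x, out y, e x y & f x = f y].
Proof.
move=> Us s1 cls out f3.
case: (pickP [pred p : V * V | [&& out p.1, out p.2,
  e p.1 p.2 & f p.1 == f p.2]]) => [[x y]|none].
  by case/and4P=> /= ox oy exy /eqP; exists x, y.
have [p [q [ps qs pq]]] : exists p q, [/\ p \in s, q \in s & p != q].
  case: s s1 Us {cls out f3 none} => [|p [|q s]] //= _ /andP[+ _];
    rewrite inE negb_or => /andP[pq _].
  by exists p, q; rewrite !inE !eqxx ?orbT.
have epq := cls p q ps qs pq.
have inK x : ~~ out x -> (x \in s) || all (e x) s by rewrite negb_and !negbK.
have K_all x w : ~~ out x -> w \in s -> w != x -> e x w.
  by move=> /inK/orP[xs|/allP xa] ws wx; [apply: cls; rewrite // eq_sym|apply: xa].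
have K_clique x y : ~~ out x -> ~~ out y -> x != y -> e x y.
  move=> ox oy xy; have [xs|xs] := boolP (x \in s).
    by rewrite e_sym; apply: K_all.
  have [ys|ys] := boolP (y \in s); first by apply: K_all; rewrite // eq_sym.
  have ne w z : w \in s -> z \notin s -> w != z by move=> ws; apply: contraNneq => <-.
  apply: (diamond_free xy epq); rewrite e_sym; apply: K_all => //; exact: ne.
have absorb x u w : ~~ out u -> ~~ out w -> u != w -> e x u -> e x w -> ~~ out x.
  move=> ou ow uw xu xw; rewrite negb_and !negbK; have [//|xs /=] := boolP (x \in s).
  apply/allP=> z zs; have [<-//|uz] := eqVneq u z; have [<-//|wz] := eqVneq w z.
  have xz : x != z by apply: contraNneq xs => ->.
  by apply: (diamond_free xz (K_clique u w ou ow uw)); rewrite 1?e_sym // e_sym K_all // eq_sym.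
pose K := [set x | ~~ out x].
have Kk : #|K| <= k by apply: small_cliques => x y; rewrite !inE; apply: K_clique.
pose r x := index x (enum K).
have r_lt x : ~~ out x -> r x < #|K| by move=> ox; rewrite cardE index_mem mem_enum inE.
have r_inj x y : ~~ out x -> ~~ out y -> r x = r y -> x = y.
  by move=> ox oy rE; rewrite -(@nth_index _ x x (enum K)) ?mem_enum ?inE // -/(r x) rE
    nth_index // mem_enum inE.
pose meets x j := [exists y, [&& ~~ out y, e x y & r y == j]].
(* Class [j] owns the colours [2j] and [2j+1]; the second is used exactly when the neighbour of [x]
   in the clique has the first. Three classes need six colours, and [k] is at least 6. *)
pose g x := if out x then (f x).*2 + meets x (f x).*2 else r x.
have g_inj x y : out x -> out y -> e x y -> g x != g y.
  move=> ox oy exy; rewrite /g ox oy; have := none (x, y); rewrite /= ox oy exy /=.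
  by apply: contraFneq => E; apply/eqP; have := congr1 half E;
    rewrite ![_.*2 + _]addnC !half_bit_double.
have g_mix x y : out x -> ~~ out y -> e x y -> g x != r y.
  move=> ox oy exy; rewrite /g ox; apply/eqP; case: (boolP (meets _ _)) => [/existsP[u /and3P[ou
    xu /eqP ru]]|nm] E.
    have uy : u != y by apply/eqP=> uy; move: E; rewrite -uy ru addn1 => /eqP; rewrite gtn_eqF.
    by have := absorb x u y ou oy uy xu exy; rewrite ox.
  by case/existsP: nm; exists y; rewrite oy exy -E addn0 eqxx.
have gr z : ~~ out z -> g z = r z by rewrite /g => /negbTE->.
case: (@uncolourable g); split=> [x|x y _ _ exy].
  rewrite /g; case: ifP => [ox|/negbT ox]; last exact: leq_trans (r_lt x ox) Kk.
  apply: leq_trans k_ge6; have := f3 x ox; case: (f x) => [|[|[|]]] // _; by case: (meets _ _).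
case: (boolP (out x)) => ox; case: (boolP (out y)) => oy.
- exact: g_inj.
- by rewrite (gr y) ?g_mix.
- by rewrite (gr x) // eq_sym g_mix // e_sym.
rewrite !gr //; apply: contraTneq exy => /(r_inj x y ox oy) ->.
by rewrite e_irr.
Qed.

(* If no edge in the neighbourhood of [v] has colours [a] and [b], then some Kempe chain
   joins an [a]-neighbour of [v] to a [b]-neighbour; a shortest one has four vertices,
   because a longer one would contain a P6. *)
Section Kempe.
Variables (v : V) (c : V -> nat) (a b : nat).
Hypotheses (c_proper : proper [set~ v] c) (a_lt : a < k) (b_lt : b < k) (ab : a != b).

Let P z := (z != v) && ((c z == a) || (c z == b)).
Let A z := e v z && (c z == a).
Let B z := e v z && (c z == b).
Let step (S : {set V}) := S :|: [set z | P z && [exists u in S, e u z]].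
(** Balls around the [a]-coloured neighbours of [v], for the distance in the subgraph of colours [a]
    and [b]. *)
Let ball n := iter n step [set z | A z].

Let A_P z : A z -> P z.
Proof. by case/andP=> ez cz; rewrite /P cz eq_sym edge_neq. Qed.

Let ball_P n z : z \in ball n -> P z.
Proof.
by elim: n => [|n IH]; rewrite !inE; [apply: A_P|case/orP=> [/IH|/andP[]]].
Qed.

Let ball_le n m z : n <= m -> z \in ball n -> z \in ball m.
Proof.
by elim: m => [|m IH]; [rewrite leqn0 => /eqP->|rewrite leq_eqVlt => /orP[/eqP->//|/IH h /h]];
  rewrite /= inE => ->.
Qed.

Let ball_edge n u z : u \in ball n -> P z -> e u z -> z \in ball n.+1.
Proof. by move=> un Pz euz; rewrite !inE Pz orbC; apply/orP; left; apply/exists_inP;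
  exists u. Qed.

Let colour_change u z : P u -> P z -> e u z -> (c u == a) = (c z == b).
Proof.
case/andP=> uv /orP cu /andP[zv /orP cz] euz.
have := c_proper.2 u z; rewrite !inE uv zv => /(_ isT isT euz).
by case: cu cz => /eqP-> [] /eqP->; rewrite ?eqxx // eq_sym => /negbTE->.
Qed.

(** Otherwise exchanging [a] and [b] on the components that meet [A] leaves no neighbour of [v]
    coloured [a], against [extend_at]. *)
Let meets : exists n, [exists u in ball n, B u].
Proof.
pose r u w := [&& P u, P w & e u w].
pose R z := [exists x, A x && connect r x z].
have R_P z : R z -> P z.
  case/existsP=> x /andP[Ax /connectP[p pth ->]].
  by case/lastP: p pth => [|p w]; [rewrite /= A_P|rewrite rcons_path last_rcons => /andP[_
    /and3P[]]].
have R_step x y : R x -> P y -> e x y -> R y.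
  move=> Rx Py exy; have Px := R_P x Rx; case/existsP: Rx => w /andP[Aw wx].
  by apply/existsP; exists w; rewrite Aw (connect_trans wx) // connect1 // /r Px Py.
pose c' z := if R z then (if c z == a then b else a) else c z.
have c'_proper : proper [set~ v] c'.
  split=> [x|x y]; first by rewrite /c'; case: ifP => _; [case: ifP|apply: c_proper.1].
  have mixed u w : w != v -> R u -> ~~ R w -> e u w -> (if c u == a then b else a) != c w.
    move=> wv Ru nRw euw; apply: contraNneq nRw => E; apply: (R_step u) => //.
    by rewrite /P wv -E; case: ifP; rewrite eqxx ?orbT.
  rewrite !inE => xv yv exy; rewrite /c'.
  case: (boolP (R x)) => Rx; case: (boolP (R y)) => Ry.
  - have [Px Py] := (R_P x Rx, R_P y Ry).
    rewrite (colour_change Px Py exy); have [E|cyb] := eqVneq (c y) b.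
      by rewrite E [b == a]eq_sym (negbTE ab) eq_sym.
    by case/andP: Py => _; rewrite (negbTE cyb) orbF => ->.
  - exact: mixed.
  - by rewrite eq_sym mixed // e_sym.
  by apply: c_proper.2; rewrite ?inE.
have [u evu] := extend_at c'_proper a_lt; rewrite /c'.
case: (boolP (R u)) => [Ru|nRu cu]; last first.
  case/existsP: nRu; exists u; by rewrite /A evu cu eqxx connect0.
case: eqP => [_ E|cua _]; first by move: ab; rewrite E eqxx.
have Bu : B u.
  by rewrite /B evu; case/andP: (R_P u Ru) => _ /orP[/eqP|].
case/existsP: Ru => x /andP[Ax /connectP[p pth uE]].
exists (size p); apply/exists_inP; exists u => //; rewrite uE.
have x0 : x \in ball 0 by rewrite inE.
have : last x p \in ball (0 + size p).
  elim: p x 0 pth x0 {Ax uE} => [|y p IH] x n /=; first by rewrite addn0.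
  by case/andP=> /and3P[_ Py exy] pth xn; rewrite addnS -addSn; apply: IH pth _;
    apply: ball_edge exy.
by rewrite add0n.
Qed.

Let layer n z := (z \in ball n) && (if n is m.+1 then z \notin ball m else true).

Let layer_step n z : layer n.+1 z -> exists2 u, layer n u & e u z.
Proof.
case/andP=> zn1 zn; move: zn1; rewrite /= inE (negbTE zn) inE => /andP[Pz /exists_inP[u un euz]].
exists u => //; rewrite /layer un; case: n un zn => // n un zn.
by apply: contra zn => un'; apply: ball_edge euz.
Qed.

Let layer_far n m u z : layer n u -> layer m z -> n.+1 < m -> ~~ e u z.
Proof.
move=> /andP[un _]; case: m => [|[|m]] // /andP[zm zm1]; rewrite !ltnS => nm.
by apply: contra zm1 => euz; apply: (@ball_le n.+1 m.+1 z) => //;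
  apply: ball_edge (ball_P zm) euz.
Qed.

Let layer_colour n z : layer n z -> c z = if odd n then b else a.
Proof.
elim: n z => [|n IH] z; first by rewrite /layer andbT inE => /andP[_ /eqP].
move=> lz; have [u lu euz] := layer_step lz.
have [Pu Pz] : P u /\ P z by move: lu lz => /andP[/ball_P ? _] /andP[/ball_P ? _].
have := colour_change Pu Pz euz; rewrite (IH u lu) /=; case: (odd n) => /=.
  by rewrite eq_sym (negbTE ab) => /esym; case/andP: Pz => _ /orP[/eqP//|->].
by rewrite eqxx => /esym/eqP.
Qed.

Lemma kempe :
  (exists x y, [/\ e v x, e v y, e x y, c x = a & c y = b]) \/
  (exists x p q y, [/\ e v x, e v y, c x = a & c y = b] /\
    [/\ e x p, e p q, e q y & [/\ ~~ e v p, ~~ e v q, ~~ e x q, ~~ e x y & ~~ e p y]]).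
Proof.
case: (ex_minnP meets) => n /exists_inP[y yn /andP[evy /eqP cy]] n_min.
have far m z : m < n -> z \in ball m -> c z = b -> ~~ e v z.
  move=> mn zm cz; apply: contraTN mn => evz; rewrite -leqNgt n_min //.
  by apply/exists_inP; exists z => //; rewrite /B evz cz eqxx.
have ly : layer n y.
  rewrite /layer yn; case: n yn n_min far => // n yn n_min far.
  by apply: contraL evy => yn'; apply: far yn' cy.
have := layer_colour ly; rewrite cy; case: ifP => [odd_n _|_ E]; last by move: ab; rewrite E eqxx.
have nearA m z : layer m.+1 z -> ~~ odd m.+1 -> ~~ e v z.
  move=> lz ev; have := layer_colour lz; rewrite (negbTE ev) => cz.
  have : z \notin ball 0.
    by case/andP: lz => _; apply: contra; apply: ball_le.
  by rewrite inE /A cz eqxx andbT.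
(* The distance [n] is odd: 1 gives the edge, 3 gives the path, and from 5 on the last six layers of
   a shortest chain give an induced P6. *)
case: n ly far odd_n {yn n_min} => [|[|[|[|[|n]]]]] ly far // _.
- have [x /andP[+ _] exy] := layer_step ly; rewrite inE => /andP[evx /eqP cx].
  by left; exists x, y.
- have [q lq eqy] := layer_step ly; have [p lp epq] := layer_step lq.
  have [x lx exp] := layer_step lp.
  right; exists x, p, q, y; have := lx; rewrite /layer andbT inE => /andP[evx /eqP cx].
  split; first by [].
  split=> //; split; rewrite ?(layer_far lx lq) ?(layer_far lx ly) ?(layer_far lp ly) ?(nearA _
    _ lq) //.
  by apply: (far 1); [|case/andP: lp|rewrite (layer_colour lp)].
have [z4 l4 e4] := layer_step ly; have [z3 l3 e3] := layer_step l4.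
have [z2 l2 e2] := layer_step l3; have [z1 l1 e1] := layer_step l2.
have [z0 l0 e0] := layer_step l1.
have lt i m : i.+1 < (m + i).+2 by rewrite !ltnS leq_addl.
case: (no_P6 e0 e1 e2 e3 e4 (layer_far l0 l2 (lt _ 0)) (layer_far l0 l3 (lt _ 1))
  (layer_far l0 l4 (lt _ 2)) (layer_far l0 ly (lt _ 3)) (layer_far l1 l3 (lt _ 0))
  (layer_far l1 l4 (lt _ 1)) (layer_far l1 ly (lt _ 2)) (layer_far l2 l4 (lt _ 0))
  (layer_far l2 ly (lt _ 1)) (layer_far l3 ly (lt _ 0))).
Qed.

End Kempe.

Lemma petal_closed v a x y : e v a -> x \in petal v a -> e v y -> e x y -> y \in petal v a.
Proof.
move=> eva; rewrite !inE => /andP[evx /predU1P[->|eax]] evy exy; rewrite evy /=.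
  by rewrite exy orbT.
have [//|ya /=] := eqVneq y a.
by rewrite e_sym; apply: (diamond_free ya evx evy eva exy); rewrite e_sym.
Qed.

(** * Vertices of a K4 lie in three maximal cliques *)

Section CliqueVertices.
Hypothesis F_free : avoids e [:: K4_on_C5; K4_across_C5].

(** By diamond-freeness neither [g] nor [h] is adjacent to [v2] or [v4], and they are not both
    adjacent to [v3]. This leaves exactly the two excluded graphs. *)
Lemma no_K4_meets_C5 v0 v1 v2 v3 v4 g h :
  e v0 v1 -> e v1 v2 -> e v2 v3 -> e v3 v4 -> e v4 v0 ->
  ~~ e v0 v2 -> ~~ e v0 v3 -> ~~ e v1 v3 -> ~~ e v1 v4 -> ~~ e v2 v4 ->
  e v0 g -> e v1 g -> e v0 h -> e v1 h -> e g h -> False.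
Proof.
move=> e01 e12 e23 e34 e40 n02 n03 n13 n14 n24 g0 g1 h0 h1 gh.
have e10 : e v1 v0 by rewrite e_sym.
have ne x y z : e y z -> ~~ e x z -> x != y by move=> ez; apply: contraNneq => ->.
have n24' w : e v0 w -> e v1 w -> ~~ e w v2 /\ ~~ e w v4.
  move=> w0 w1; split.
    apply: contra n02 => w2; apply: (diamond_free (ne _ _ _ e23 n03) w1 e10 e12) => //.
    by rewrite e_sym.
  apply: contra n14 => w4; apply: (diamond_free _ w0 e01) => //.
  - by rewrite (ne _ _ v3) // e_sym.
  - by rewrite e_sym.
  by rewrite e_sym.
have [g2 g4] := n24' g g0 g1; have [h2 h4] := n24' h h0 h1.
have n03' : v0 != v3 by rewrite (ne _ _ v2) // e_sym.
have nboth : e g v3 -> e h v3 -> False.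
  move=> g3 h3; case/negP: n03; apply: (diamond_free n03' gh) => //; by rewrite e_sym.
have no G x y : e x y -> e v0 x -> e v1 x -> e v0 y -> e v1 y -> ~~ e x v2 -> ~~ e x v4 -> ~~ e
  y v2 ->
    ~~ e y v4 -> ~~ e y v3 -> (if e x v3 then K4_across_C5 else K4_on_C5) = G -> False.
  move=> xy x0 x1 y0 y1 x2 x4 y2 y4 y3 GE.
  apply: (@absent V e e_sym e_irr [:: K4_on_C5; K4_across_C5] G [:: x; y; v4; v3; v2; v1;
    v0]) => //.
  + by rewrite -GE; case: ifP; rewrite !inE eqxx ?orbT.
  + by rewrite -GE; case: ifP.
  rewrite /= ![e _ v0]e_sym ![e _ v1]e_sym x0 x1 y0 y1 e10 xy -GE.
  rewrite (negbTE x2) (negbTE x4) (negbTE y2) (negbTE y3) (negbTE y4).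
  rewrite [e v4 v3]e_sym e34 [e v4 v2]e_sym (negbTE n24) (negbTE n14) [e v0 v4]e_sym e40.
  by rewrite [e v3 v2]e_sym e23 (negbTE n13) (negbTE n03) e12 (negbTE n02); case: ifP.
have [h3|h3] := boolP (e h v3); last exact: (no _ g h).
have g3 : ~~ e g v3 by apply/negP => g3; apply: nboth.
by apply: (no _ h g) => //; rewrite e_sym.
Qed.

(** Suppose that two petals cover the neighbours of [v]. Each has fewer than [k] vertices, so it
    misses a colour, [i] or [j]; hence neighbours coloured [i] lie only in the second petal and
    those coloured [j] only in the first. No edge joins them, so [kempe] gives a C5 through [v] with
    a neighbour of [v] in each petal. The petal containing [a] then yields a K4 on an edge of this
    C5. *)
Lemma three_CliqueVertices v a b c : e v a -> e v b -> e v c -> e a b -> e a c -> e b c ->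
  three_cliques e v.
Proof.
move=> va vb vc ab ac bc s1 s2 evs cl1 cl2; apply: separate => // x y evx evy cover.
have [col colP] := colour_without v.
have inU u : e v u -> (u \in petal v x) || (u \in petal v y).
  by move=> evu; have := subsetP cover u; rewrite inE in_setU => /(_ evu).
have missing d : e v d -> exists2 i, i < k & forall u, u \in petal v d -> col u != i.
  move=> evd; case: (pickP [pred i : 'I_k | [forall u in petal v d,
    col u != i]]) => [i /forall_inP|none].
    by exists i.
  have : k <= #|petal v d|.
    rewrite [#|petal v d|]cardE -(size_map col) -[k]card_ord cardE -(size_map val).
    apply: uniq_leq_size; first by rewrite (map_inj_uniq val_inj) enum_uniq.
    move=> _ /mapP[i _ ->]; have := none i; rewrite /= => /negbT/forall_inPn[u ud].
    by rewrite negbK => /eqP <-; apply: map_f; rewrite mem_enum.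
  by rewrite leqNgt petal_card.
have [i ltik ix] := missing x evx; have [j ltjk jy] := missing y evy.
have iy u : e v u -> col u = i -> u \in petal v y.
  by move=> /inU/orP[/ix/negbTE ne E|//]; rewrite E eqxx in ne.
have jx u : e v u -> col u = j -> u \in petal v x.
  by move=> /inU/orP[//|/jy/negbTE ne E]; rewrite E eqxx in ne.
have ij : i != j.
  have [u evu cu] := extend_at colP ltik.
  by apply: contraTneq (iy u evu cu) => E; apply/negP => /jy; rewrite cu E eqxx.
(* The petal of [a] also contains [b] and [c], so every edge from [v] into it lies in a K4. *)
have closed d w : e v d -> a \in petal v d -> e v w -> w \in petal v d ->
    exists g h, [/\ e v g, e w g, e v h, e w h & e g h].
  move=> evd ad evw wd.
  have bd := petal_closed evd ad vb ab; have cd := petal_closed evd ad vc ac.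
  have adj_w u : u \in petal v d -> w != u -> e w u.
    by move=> ud; apply: (petal_clique evd); rewrite in_setU ?wd ?ud orbT.
  have [wa|wa] := eqVneq w a; first by exists b, c; rewrite wa.
  have [wb|wb] := eqVneq w b; first by exists a, c; rewrite wb va vc ac bc e_sym ab.
  by exists a, b; rewrite va vb ab !adj_w.
case: (kempe colP ltik ltjk ij) => [[p [q [evp evq epq cp cq]]]|].
  by have := jy q (petal_closed evy (iy p evp cp) evq epq); rewrite cq eqxx.
case=> p [r [s [q [[evp evq cp cq] [epr ers esq [nr ns nps npq nrq]]]]]].
have [epv eqv] : e p v /\ e q v by rewrite ![e _ v]e_sym.
case/orP: (inU a va) => ad.
  have [g [h [vg qg vh qh gh]]] := closed x q evx ad evq (jx q evq cq).
  apply: (@no_K4_meets_C5 v q s r p g h); rewrite ?[e q s]e_sym ?[e s r]e_sym ?[e r p]e_sym //.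
  - by rewrite e_sym.
  - by rewrite e_sym.
  by rewrite e_sym.
have [g [h [vg pg vh ph gh]]] := closed y p evy ad evp (iy p evp cp).
exact: (@no_K4_meets_C5 v p r s q g h).
Qed.

End CliqueVertices.

Lemma no_critical_graph : False.
Proof.
have deg6 v (s : seq V) : size s < 6 -> exists2 u, e v u & u \notin s.
  by move=> lts; apply: degree_gt; apply: leq_trans k_ge6.
have run m F l three K4N := @chainP V e e_sym e_irr m deg6 not_comparable not_simplicial
  three linked diamond_free K4N not6 not3 F l.
have a0 : avoids e [:: P6; Diamond] := avoids_cat P6_free diamond_avoided.
have a1 : avoids e ([:: P6; Diamond] ++ map fst chain_K4_C5).
  by apply: (run Plain _ _ I _ a0 chain_K4_C5_ok).
have three1 : forall v a b c, e v a -> e v b -> e v c -> e a b -> e a c -> e b c ->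
    three_cliques e v.
  apply: three_CliqueVertices.
  by apply: avoids_sub a1 => G; rewrite !inE => /orP[]/eqP->.
have K4_avoided : avoids e [:: K4].
  have a2 : avoids e (([:: P6; Diamond] ++ map fst chain_K4_C5) ++ map fst chain_K4).
    by apply: (run CliqueVertices _ _ three1 _ a1 chain_K4_ok).
  by apply: avoids_sub a2 => G; rewrite mem_seq1 => /eqP->.
have K4N : NoK4 = NoK4 -> _ := fun _ => K4_free K4_avoided.
have three2 := three_NoK4 K4_avoided.
have a3 : avoids e [:: P6; Diamond; K4] := avoids_cat a0 K4_avoided.
have C5_avoided : avoids e [:: C5].
  have a4 := run NoK4 _ _ three2 K4N a3 chain_C5_ok.
  by apply: avoids_sub a4 => G; rewrite mem_seq1 => /eqP->.
have K3_avoided : avoids e [:: K3].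
  have a5 := run NoK4 _ _ three2 K4N (avoids_cat a3 C5_avoided) chain_K3_ok.
  by apply: avoids_sub a5 => G; rewrite mem_seq1 => /eqP->.
case: (pickP (@predT V)) => [v _|empty]; last first.
  apply: (@uncolourable (fun=> 0)); split=> [x|x y]; first by apply: leq_trans k_ge6.
  by have := empty x.
have [c cP] := colour_without v.
have k_gt m : m < 6 -> m < k by move=> ?; apply: leq_trans k_ge6.
(* Both outcomes are now excluded: the edge forms a triangle with [v], and the path closes up to a
   C5. *)
case: (kempe cP (k_gt 0 isT) (k_gt 1 isT) isT).
  case=> x [y [evx evy exy _ _]].
  by apply: (@absent V e e_sym e_irr _ _ [:: v; x; y] K3_avoided (mem_head _ _));
    rewrite //= evx evy exy.
case=> x [p [q [y [[evx evy _ _] [exp epq eqy [nvp nvq nxq nxy npy]]]]]].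
apply: (@absent V e e_sym e_irr _ _ [:: v; x; p; q; y] C5_avoided (mem_head _ _)); rewrite //=.
by rewrite evx evy exp epq eqy (negbTE nvp) (negbTE nvq) (negbTE nxq) (negbTE nxy) (negbTE npy).
Qed.

End Critical.

(** * Colouring *)

Section Colouring.
Variables (V : finType) (e : rel V) (k : nat).
Hypotheses (e_sym : symmetric e) (e_irr : irreflexive e).
Hypotheses (P6_free : avoids e [:: P6]) (diamond_avoided : avoids e [:: Diamond]).
Hypothesis k_ge6 : 6 <= k.
Hypothesis small_cliques : forall A : {set V},
  {in A &, forall x y, x != y -> e x y} -> #|A| <= k.

(** A minimal vertex set without a [k]-colouring induces a critical graph, handled as a graph on the
    subtype. *)
Lemma colouring_exists : exists c : {ffun V -> 'I_k}, forall x y, e x y -> c x != c y.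
Proof.
pose good (S : {set V}) (c : {ffun V -> 'I_k}) :=
  [forall x in S, forall y in S, e x y ==> (c x != c y)].
have goodP (S : {set V}) (c : {ffun V -> 'I_k}) : reflect {in S &, forall x y,
  e x y -> c x != c y} (good S c).
  apply: (iffP idP) => [/forall_inP gc x y xS yS exy|gc].
    by have /forall_inP/(_ y yS) := gc x xS; rewrite exy.
  apply/forall_inP=> x xS; apply/forall_inP=> y yS; apply/implyP; exact: gc.
case: (boolP [exists c, good setT c]) => [/existsP[c /goodP gc]|bad].
  by exists c => x y; apply: gc.
have [S /minsetP[nS minS]] := ex_minset (ex_intro (fun S => ~~ [exists c, good S c]) _ bad).
pose T := {x | x \in S}; pose e' (x y : T) := e (val x) (val y).
have adjm' us : adjm e' us = adjm e (map val us).
  by elim: us => //= u us ->; rewrite -map_comp.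
have avoid' F : avoids e F -> avoids e' F.
  by move=> aF us Uus; rewrite adjm' aF // map_inj_uniq //; apply: val_inj.
exfalso; apply: (@no_critical_graph T e' k) => //; try exact: avoid'.
- by move=> x y; apply: e_sym.
- by move=> x; apply: e_irr.
- move=> A cl; rewrite -(card_imset _ val_inj); apply: small_cliques.
  move=> _ _ /imsetP[x xA ->] /imsetP[y yA ->] ne.
  by apply: (cl x y xA yA); apply: contraNneq ne => ->.
- move=> A AT; case: (boolP [exists c, good (val @: A) c]) => [/existsP[c /goodP gc]|nA].
    exists (fun x : T => nat_of_ord (c (val x))); split=> // x y xA yA exy.
    by rewrite (inj_eq val_inj) gc ?imset_f.
  case/eqP: AT; apply/setP=> x; rewrite inE.
  have sub : val @: A \subset S by apply/subsetP=> _ /imsetP[y _ ->]; apply: valP.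
  have : val x \in val @: A by rewrite (minS _ nA sub); apply: valP.
  by case/imsetP=> y yA /val_inj->.
move=> c [ck cP]; case/existsP: nS.
have k_gt0 : 0 < k by apply: leq_trans k_ge6.
(* Colour 0 outside [S] is a dummy, since [good S] tests pairs in [S] only. *)
exists [ffun x => if insub x is Some u then Ordinal (ck u) else Ordinal k_gt0].
apply/goodP=> x y xS yS exy; rewrite !ffunE !insubT -val_eqE /=.
exact: cP.
Qed.

End Colouring.

(** A vertex list with matrix [M] induces a copy of the graph, each vertex being sent to its
    position in the list. *)
Lemma avoids_induced (G : sgraph) n (r : rel 'I_n) (r_sym : symmetric r)
    (r_irr : irreflexive r) (M : matrix) :
  size M = n -> (forall i j : 'I_n, r i j = adj M i j) ->
  ~ contains G (SGraph r_sym r_irr) -> avoids (@edge G) [:: M].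
Proof.
move=> sM rE nc us Uus; rewrite inE; apply/eqP => ME; apply: nc.
have su : size us = n by rewrite -sM -ME size_adjm.
exists [set x in us].
have idx (x : induced [set x in us]) : index (val x) us < n.
  by rewrite -su index_mem; have := valP x; rewrite inE.
pose f x : SGraph r_sym r_irr := Ordinal (idx x).
have memf (x : induced [set x in us]) : val x \in us by have := valP x; rewrite inE.
exists f; last first.
  move=> x y; rewrite /= rE -ME (adj_adjm (@edge_sym G) (@edge_irr G) (val x)) ?index_mem //.
  by rewrite !nth_index.
apply: inj_card_bij.
  move=> x y /(congr1 val) /= E; apply: val_inj.
  by rewrite -(nth_index (val x) (memf x)) E nth_index //; apply: memf.
by rewrite card_ord card_sig -su -(card_uniqP Uus); apply: subset_leq_card; apply/subsetP=> x;
  rewrite !inE.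
Qed.

Theorem theorem5 (G : sgraph)
    (P6_free : ~ contains G (path_graph 6))
    (diamond_free : ~ contains G diamond) :
  chi G <= maxn 6 (omega G).
Proof.
have aP6 : avoids (@edge G) [:: P6].
  apply: avoids_induced P6_free => // i j.
  by case: i j => [[|[|[|[|[|[|i]]]]]] ?] [[|[|[|[|[|[|j]]]]]] ?].
have aD : avoids (@edge G) [:: Diamond].
  apply: avoids_induced diamond_free => // i j.
  (* Equality of the two pairs becomes membership tests, which compute on each of the sixteen index
     pairs. *)
  rewrite /remove_edge_edge eqEsubset !subUset !sub1set !inE.
  by case: i j => [[|[|[|[|i]]]] ?] [[|[|[|[|j]]]] ?].
have small (A : {set G}) : {in A &, forall x y : G, x != y -> edge x y} -> #|A| <= maxn 6 (omega
  G).
  move=> cl; rewrite leq_max; apply/orP; right; apply: (leq_bigmax_cond A).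
  by apply/forall_inP=> x xA; apply/forall_inP=> y yA; apply/implyP; apply: cl.
have [c cP] := colouring_exists (@edge_sym G) (@edge_irr G) aP6 aD (leq_maxl _ _) small.
rewrite /chi; case: ex_minnP => m _; apply; apply/existsP; exists c.
by apply/forallP=> x; apply/forallP=> y; apply/implyP; apply: cP.
Qed.
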